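(* For a parking function $a\in P_n$, define $Q_a=\sum_{b\in P_n,\ a\le_* b}M_b$ in ${\rm PFSym}$; these elements form a basis of ${\rm PFSym}$. Then for all $a\in P_m$ and $b\in P_n$: $$Q_a\star Q_b=Q_{a|b},$$ and $$\Delta(Q_a)=\sum Q_{{\rm Park}(a')}\otimes Q_{{\rm Park}(a'')},$$ where the sum runs over ordered pairs $(a',a'')$ of subwords of $a$ with $F_{a'}\cap F_{a''}=\emptyset$ and $F_{a'}\cup F_{a''}=F_a$. In particular, the set $\{Q_a: a\in\mathcal{A}P\}$ freely generates the algebra ${\rm PFSym}$.
   Context: $\mathbb{K}$ is a field of characteristic zero. Words. Words are finite words on positive integers. $\epsilon$ is the empty word, $\cdot$ is concatenation, and $w+k$ adds $k$ to each letter of $w$. Parking functions. A word $a\in[n]^n$ is a parking function of length $n$ if its nondecreasing rearrangement $b_1\le\cdots\le b_n$ satisfies $b_i\le i$. $P_n$ is the set of these, $P_0=\{\epsilon\}$. LR-decomposition. Let $a=a_1\cdots a_n$ be nonempty. A position $i$ is a left-to-right minimum if $i=1$, or if $a_i<a_j$ for all $j<i$. Let $i_1<\cdots<i_s$ be these positions and $i_{s+1}=n+1$. Set $w_j=a_{i_{s+1-j}}\cdots a_{i_{s+2-j}-1}$. Then $F_a=(w_1,\ldots,w_s)$ (so $a=w_s\cdots w_1$), identified with the set of its words; $F_\epsilon=()$. A set of words, each beginning with its minimum and with distinct minima, is the LR-decomposition of the concatenation of its words in decreasing order of minima. A subword $a'$ of $a$ with $F_{a'}\subseteq F_a$ arises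 in this way from a subset of $F_a$. ${\rm PFSym}$. This is $\bigoplus_{n\ge0}\mathbb{K}\{M_a:a\in P_n\}$, $M_\epsilon=1$, with the following operations. - Product: $M_a\star M_\epsilon=M_\epsilon\star M_a=M_a$. For $a\in P_m$ and $b\in P_n$ with $m,n\ge1$, $M_a\star M_b=\sum_\Theta M_{a\Theta b}$. The sum is over all matchings $\Theta$ (including empty) between $F_a$ and $F_b+m$, and $a\Theta b$ is the parking function whose LR-decomposition is obtained from $F_a\cup(F_b+m)$ by replacing each edge $(u,w+m)$ by $u\cdot(w+m)$. - Coproduct: $\Delta(M_a)=\sum M_{{\rm Park}(a')}\otimes M_{{\rm Park}(a'')}$, over ordered pairs of subwords $(a',a'')$ with $F_{a'}\sqcup F_{a''}=F_a$. Parkization. For a word $a=a_1\cdots a_n$ put $d(a)=\min\{i:|\{j:a_j\le i\}|<i\}$. If $d(a)=n+1$, then ${\rm Park}(a)=a$. Otherwise ${\rm Park}(a)={\rm Park}(\bar a)$, where $\bar a$ decreases by $1$ each letter greater than $d(a)$. Also ${\rm Park}(\epsilon)=\epsilon$. Partial order. For $a,b\in P_n$ with $F_a=(w_1,\ldots,w_r)$, $b$ covers $a$ if there exist $1\le i<j\le r$ such that every letter of $w_i$ is $\le$ every letter of $w_j$ and $F_b=(w_1,\ldots,w_{i-1},w_i\cdot w_j,w_{i+1},\ldots,w_{j-1},w_{j+1},\ldots,w_r)$. $\le_*$ is the partial order on $P_n$ generated by these covering relations. Slash product. For $a=a_1\cdots a_m\in P_m$ and $b=b_1\cdots b_n\in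 P_n$, $a|b=(b_1+m)\cdots(b_n+m)a_1\cdots a_m$. A nonempty parking function is atomic if it is not $b|c$ for nonempty parking functions $b$ and $c$. $\mathcal{A}P$ is the set of atomic parking functions. *)

(* Defs.v *)
From HB Require Import structures.
From mathcomp Require Import all_boot all_algebra finmap boolp monalg zify.
From Stdlib Require Import Relations.
Set Implicit Arguments.
Unset Strict Implicit.
Unset Printing Implicit Defensive.
Import GRing.Theory.
Local Open Scope ring_scope.

(* Letters are positive integers; this is imposed where it matters, in
   is_pf. *)
Notation word := (seq nat).

Definition shiftw (w : word) (k : nat) : word := [seq (x + k)%N | x <- w].

(* b_1 <= ... <= b_n is sort leq w, indexed here from 0. *)
Definition is_pf (w : word) : bool :=
  all (fun x => 0 < x <= size w)%N w &&
  all (fun i => nth 0%N (sort leq w) i <= i.+1)%N (iota 0 (size w)).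

Record pf := PF { pfw :> word; pfP : is_pf pfw }.
HB.instance Definition _ := [isSub for pfw].
HB.instance Definition _ := [Countable of pf by <:].

Definition pf_eps : pf := @PF [::] isT.

Definition Pn (n : nat) : seq pf :=
  pmap insub [seq [seq (val i).+1 | i <- t] | t : n.-tuple 'I_n].

Lemma Pn_uniq n : uniq (Pn n).
Proof.
apply: pmap_sub_uniq; rewrite map_inj_uniq ?enum_uniq // => s t.
by move/(@inj_map _ _ (fun i : 'I_n => (val i).+1)) => H;
   apply/val_inj/H => i j [] /val_inj.
Qed.

Lemma mem_Pn n (a : pf) : (a \in Pn n) = (size a == n).
Proof.
rewrite mem_pmap_sub; apply/mapP/eqP => [[t _ ->]|sa].
  by rewrite size_map size_tuple.
have /andP[/allP ha _] := pfP a.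
have q i : (i < n)%N -> (0 < nth 0%N a i <= n)%N.
  by move=> li; rewrite -sa; apply: ha; rewrite mem_nth ?sa.
have p i : (i < n)%N -> ((nth 0%N a i).-1 < n)%N.
  by move=> /q; lia.
exists [tuple Ordinal (p i (ltn_ord i)) | i < n]; first exact: mem_enum.
apply: (@eq_from_nth _ 0%N); first by rewrite size_map size_tuple sa.
move=> i; rewrite sa => lin.
have sz : size [tuple Ordinal (p i (ltn_ord i)) | i < n] = n.
  by rewrite size_tuple.
rewrite (nth_map (Ordinal lin)) ?sz //.
rewrite -[i]/(val (Ordinal lin)) -tnth_nth tnth_mktuple /=.
by have := q _ lin; lia.
Qed.

Lemma is_pf_count (w : word) :
  is_pf w = all (ltn 0) w &&
            all (fun i => i <= count (fun x => x <= i) w)%N (iota 0 (size w).+1).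
Proof.
have ss := sort_sorted leq_total w.
have cs p : count p (sort leq w) = count p w.
  by apply/seq.permP; rewrite perm_sort.
have sz : size (sort leq w) = size w by rewrite size_sort.
apply/andP/andP => -[/allP h1 /allP h2]; split; apply/allP.
- by move=> x /h1 /andP[].
- move=> [|i]; rewrite mem_iota // add0n ltnS => /= li.
  rewrite -cs -[sort leq w](cat_take_drop i.+1) count_cat.
  apply: leq_trans (leq_addr _ _).
  have -> : count (fun x => x <= i.+1)%N (take i.+1 (sort leq w)) =
            size (take i.+1 (sort leq w)).
    apply/eqP; rewrite -all_count; apply/(all_nthP 0%N) => j.
    rewrite size_takel ?sz // => lj; rewrite nth_take //.
    have := h2 i; rewrite mem_iota add0n => /(_ li); apply: leq_trans.
    by apply: (sorted_leq_nth leq_trans leqnn) => //; rewrite inE ?sz //; lia.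
  by rewrite size_takel ?sz.
- have := h2 (size w); rewrite mem_iota add0n ltnSn => /(_ isT) c x xw.
  apply/andP; split; first exact: (h1 x xw).
  have : count (fun x => x <= size w)%N w == size w by rewrite eqn_leq count_size.
  by rewrite -all_count => /allP /(_ x xw).
- move=> i; rewrite mem_iota add0n => /= li; rewrite leqNgt; apply/negP => hi.
  have := h2 i.+1; rewrite mem_iota add0n ltnS => /(_ li).
  rewrite -cs -[sort leq w](cat_take_drop i) count_cat.
  have -> : count (fun x => x <= i.+1)%N (drop i (sort leq w)) = 0%N.
    apply/eqP; rewrite -leqn0 leqNgt -has_count; apply/negP.
    move=> /(has_nthP 0%N)[j]; rewrite size_drop sz nth_drop => lj.
    apply/negP; rewrite -ltnNge; apply: leq_trans hi _.
    by apply: (sorted_leq_nth leq_trans leqnn) => //; rewrite ?inE ?sz; lia.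
  have := count_size (fun x => x <= i.+1)%N (take i (sort leq w)).
  by rewrite size_takel ?sz ?(ltnW li) //; lia.
Qed.

Lemma is_pfP (w : word) :
  reflect ((forall x, x \in w -> 0 < x)%N /\
           forall i, (i <= size w)%N -> (i <= count (fun x => x <= i) w)%N)
          (is_pf w).
Proof.
rewrite is_pf_count; apply: (iffP andP) => -[h1 h2].
  split=> [x xw|i li]; first exact: (allP h1).
  by apply: (allP h2 i); rewrite mem_iota.
by split; apply/allP => x; rewrite ?mem_iota ?ltnS; [apply: h1|move/h2].
Qed.

Lemma is_pf_cat (w1 w2 : word) :
  is_pf w1 -> is_pf w2 -> is_pf (w1 ++ shiftw w2 (size w1)).
Proof.
move=> /is_pfP[p1 c1] /is_pfP[p2 c2]; apply/is_pfP; split=> [x|i].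
  rewrite mem_cat => /orP[/p1 //|/mapP[y /p2 ? ->]]; lia.
rewrite size_cat size_map count_cat count_map => li.
case: (leqP i (size w1)) => h; first exact: leq_trans (c1 i h) (leq_addr _ _).
have -> : count (preim (fun x => x + size w1)%N (fun x => x <= i)%N) w2 =
          count (fun x => x <= i - size w1)%N w2.
  by apply: eq_count => x /=; lia.
have := c2 (i - size w1)%N; have := c1 (size w1) (leqnn _).
have : (count (fun x => x <= size w1) w1 <= count (fun x => x <= i) w1)%N.
  by apply: sub_count => x /= ?; lia.
lia.
Qed.

Lemma is_pf_perm (w1 w2 : word) : perm_eq w1 w2 -> is_pf w1 = is_pf w2.
Proof.
move=> h; rewrite !is_pf_count (perm_all _ h) (perm_size h).
by congr andb; apply: eq_all => i; rewrite (seq.permP h).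
Qed.

(* The default value pf_eps is never used below: see join_is_pf, val_slash and
   val_Park. *)
Definition to_pf (w : word) : pf := insubd pf_eps w.

Definition is_lrmin (a : word) (i : nat) : bool :=
  all (fun j => nth 0 a i < nth 0 a j)%N (iota 0 i).

(* 0-based positions i_1 < ... < i_s of the left-to-right minima *)
Definition lrpos (a : word) : seq nat :=
  [seq i <- iota 0 (size a) | is_lrmin a i].

(* The sequence (w_1, ..., w_s): the factors of a between consecutive
   left-to-right minima, read from right to left. *)
Definition LR (a : word) : seq word :=
  rev [seq drop p.1 (take p.2 a)
      | p <- zip (lrpos a) (rcons (behead (lrpos a)) (size a))].

Definition Fset (a : word) : {fset word} := [fset w in LR a]%fset.

(* Concatenation in decreasing order of minima; the words in S are meant to
   begin with their minima, which are distinct. *)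
Definition wcat (S : {fset word}) : word :=
  flatten (sort (fun u v : word => head 0 v <= head 0 u)%N (enum_fset S)).

Definition is_matching (T : {fset word * word}) : bool :=
  [forall e : T, forall f : T,
     (((val e).1 == (val f).1) || ((val e).2 == (val f).2)) ==> (e == f)].

Definition matchings (A B : {fset word}) : seq {fset word * word} :=
  [seq T <- enum_fset (fpowerset (A `*` B)%fset) | is_matching T].

Definition joinF (A B : {fset word}) (T : {fset word * word}) : {fset word} :=
  (((A `|` B) `\` ([fset e.1 | e in T] `|` [fset e.2 | e in T]))
    `|` [fset (e.1 ++ e.2 : word) | e in T])%fset.

Definition Fshift (b : word) (m : nat) : {fset word} :=
  [fset shiftw w m | w in Fset b]%fset.

Definition join (a b : word) (T : {fset word * word}) : word :=
  wcat (joinF (Fset a) (Fshift b (size a)) T).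

Lemma park_dP (a : word) :
  exists i, (count (fun x => x <= i) a < i)%N.
Proof. by exists (size a).+1; rewrite ltnS count_size. Qed.

Definition park_d (a : word) : nat := ex_minn (park_dP a).

Definition park_bar (a : word) : word :=
  [seq if (park_d a < x)%N then x.-1 else x | x <- a].

(* One step of the recursion for Park; each step which is not the identity
   decreases the sum of the letters, so sumn a steps are enough (see parkE). *)
Definition park_step (a : word) : word :=
  if park_d a == (size a).+1 then a else park_bar a.

Definition park (a : word) : word := iter (sumn a) park_step a.

Lemma park_d_leq a : (park_d a <= (size a).+1)%N.
Proof.
by rewrite /park_d; case: ex_minnP => m _; apply; rewrite ltnS count_size.
Qed.

Lemma park_d_is_pf a : (forall x, x \in a -> 0 < x)%N ->
  is_pf a = (park_d a == (size a).+1).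
Proof.
move=> pa; apply/is_pfP/eqP => [[_ h]|].
  apply/eqP; rewrite eqn_leq park_d_leq /= /park_d; case: ex_minnP => m h1 _.
  by rewrite ltnNge; apply/negP => /h; rewrite leqNgt h1.
rewrite /park_d; case: ex_minnP => m _ h e; split=> // i li.
by rewrite leqNgt; apply/negP => /h; rewrite e ltnNge li.
Qed.

Lemma sumn_park_bar a : park_d a != (size a).+1 ->
  (sumn (park_bar a) < sumn a)%N.
Proof.
move=> h; have {h} : (park_d a <= size a)%N.
  by have := park_d_leq a; rewrite leq_eqVlt (negbTE h).
have : (count (fun x => x <= park_d a) a < park_d a)%N.
  by rewrite /park_d; case: ex_minnP.
rewrite /park_bar; move: (park_d a) => d h1 h2.
have {h1 h2} : has (fun x => d < x)%N a.
  have := count_predC (fun x => x <= d)%N a; rewrite has_count.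
  have -> : count (predC (fun x => x <= d)%N) a = count (fun x => d < x)%N a.
    by apply: eq_count => x /=; rewrite -ltnNge.
  by lia.
have le s : (sumn [seq if d < y then y.-1 else y | y <- s] <= sumn s)%N.
  by elim: s => //= y s IH; case: ifP; lia.
elim: a => // x a IH; rewrite [map _ _]/= [sumn (_ :: _)]/= [sumn (x :: _)]/=.
rewrite [has _ _]/=; case: ifP => dx /=; first by have := le a; lia.
by move=> /IH; lia.
Qed.

Lemma iter_park_step k l a : (sumn a <= k)%N -> (sumn a <= l)%N ->
  iter k park_step a = iter l park_step a.
Proof.
have fixed j b : park_d b = (size b).+1 -> iter j park_step b = b.
  by move=> hb; elim: j => //= j ->; rewrite /park_step hb eqxx.
elim: k l a => [|k IH] l a hk hl; case: (eqVneq (park_d a) (size a).+1) => hd.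
- by rewrite !fixed.
- by have := sumn_park_bar hd; lia.
- by rewrite !fixed.
have lt := sumn_park_bar hd; case: l hl => [|l] hl; first by lia.
rewrite !iterSr {2 4}/park_step (negbTE hd); apply: IH; lia.
Qed.

Lemma parkE a :
  park a = if park_d a == (size a).+1 then a else park (park_bar a).
Proof.
rewrite {1}/park; case: eqVneq => hd.
  by elim: (sumn a) => //= j ->; rewrite /park_step hd eqxx.
have lt := sumn_park_bar hd.
rewrite /park; case: (sumn a) lt => [//|n] lt.
rewrite iterSr [park_step a]/park_step (negbTE hd).
exact: iter_park_step.
Qed.

Lemma park_bar_gt0 a :
  (forall x, x \in a -> 0 < x)%N -> forall x, x \in park_bar a -> (0 < x)%N.
Proof.
move=> pa x /mapP[y ya ->]; case: ifP (pa _ ya) => //.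
rewrite /park_d; case: ex_minnP => -[//|m] _ _; lia.
Qed.

Lemma park_is_pf a : (forall x, x \in a -> 0 < x)%N -> is_pf (park a).
Proof.
have [n] := ubnP (sumn a); elim: n a => // n IH a lt pa; rewrite parkE.
case: ifP => hd; first by rewrite park_d_is_pf.
apply: IH; last exact: park_bar_gt0.
by have := sumn_park_bar (negbT hd); lia.
Qed.

Lemma flatten_factors (a : word) p ps :
  sorted ltn (p :: ps) -> all (fun i => i < size a)%N (p :: ps) ->
  flatten [seq drop q.1 (take q.2 a)
          | q <- zip (p :: ps) (rcons ps (size a))] = drop p a.
Proof.
elim: ps p => [|q ps IH] p /=; first by rewrite take_size cats0.
move=> /andP[pq so] /and3P[hp hq hs]; rewrite IH //=; last by rewrite hq.
rewrite -[in RHS](cat_take_drop q a) drop_cat size_takel ?(ltnW hq) //.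
by rewrite pq.
Qed.

Lemma lrpos_sorted a : sorted ltn (lrpos a).
Proof. by apply: sorted_filter (iota_ltn_sorted _ _); apply: ltn_trans. Qed.

Lemma lrpos_lt a : all (fun i => i < size a)%N (lrpos a).
Proof. by apply/allP => i; rewrite mem_filter mem_iota => /and3P[]. Qed.

Lemma lrpos_cons a : (0 < size a)%N -> exists ps, lrpos a = 0%N :: ps.
Proof.
by case: a => // x a _; rewrite /lrpos /=; exists [seq i <- iota 1 (size a) | is_lrmin (x :: a) i].
Qed.

Lemma flatten_LR a : flatten (rev (LR a)) = a.
Proof.
rewrite /LR revK; case: (posnP (size a)) => [/size0nil -> //|/lrpos_cons[ps e]].
have := lrpos_lt a; have := lrpos_sorted a; rewrite e => h1 h2.
by rewrite flatten_factors // drop0.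
Qed.

Lemma heads_factors (a : word) p ps :
  sorted ltn (p :: ps) -> all (fun i => i < size a)%N (p :: ps) ->
  [seq (head 0%N w) | w <- [seq drop q.1 (take q.2 a)
          | q <- zip (p :: ps) (rcons ps (size a))]] =
  [seq nth 0%N a i | i <- p :: ps].
Proof.
elim: ps p => [|q ps IH] p /=; first by rewrite andbT -nth0 nth_drop take_size addn0.
move=> /andP[pq so] /and3P[hp hq hs].
have /= -> := IH q so ltac:(by rewrite /= hq hs).
by rewrite -nth0 nth_drop addn0 nth_take.
Qed.

Lemma heads_LR a : [seq head 0%N w | w <- rev (LR a)] = [seq nth 0%N a i | i <- lrpos a].
Proof.
rewrite /LR revK; case: (posnP (size a)) => [/size0nil -> //|/lrpos_cons[ps e]].
by have := lrpos_lt a; have := lrpos_sorted a; rewrite e => h1 h2; rewrite heads_factors.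
Qed.

Lemma LR_uniq a : uniq (LR a).
Proof.
rewrite -rev_uniq; apply: (@map_uniq _ _ (head 0%N)); rewrite heads_LR.
rewrite map_inj_in_uniq ?filter_uniq ?iota_uniq // => i j.
rewrite !mem_filter !mem_iota /= !add0n => /andP[/allP mi _] /andP[/allP mj _] e.
apply/eqP; rewrite eqn_leq; apply/andP; split; rewrite leqNgt; apply/negP => lt.
  by have := mi j; rewrite mem_iota e ltnn => /(_ lt).
by have := mj i; rewrite mem_iota e ltnn => /(_ lt).
Qed.

Lemma LR_nonnil a : [::] \notin LR a.
Proof.
apply/negP; rewrite -mem_rev /LR revK => /mapP[[p q]].
case: (posnP (size a)) => [/size0nil -> //|/lrpos_cons[ps e]].
have := lrpos_lt a; have := lrpos_sorted a; rewrite e /=.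
elim: ps (0%N) {e} => [|r ps IH] p0 /=.
  rewrite andbT => _ lt; rewrite inE => /eqP[-> ->] /= /(congr1 size).
  by rewrite take_size size_drop /=; lia.
move=> /andP[pr so] /and3P[h1 h2 h3]; rewrite inE => /orP[/eqP[-> ->] /= /(congr1 size)|].
  by rewrite size_drop size_takel ?(ltnW h2) //=; lia.
by apply: IH => //; rewrite h2.
Qed.

Lemma mem_Fset a w : (w \in Fset a) = (w \in LR a).
Proof. by rewrite /Fset in_fset. Qed.

Lemma count_Fset P a : (\sum_(w <- Fset a) count P w = count P a)%N.
Proof.
have h : perm_eq (Fset a) (LR a).
  by apply: uniq_perm; rewrite ?fset_uniq ?LR_uniq // => w; rewrite mem_Fset.
rewrite (perm_big _ h) -[in RHS](flatten_LR a) count_flatten sumnE !big_map.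
by apply: perm_big; rewrite perm_sym perm_rev.
Qed.

Lemma count_wcat P S : (count P (wcat S) = \sum_(w <- S) count P w)%N.
Proof.
rewrite /wcat count_flatten sumnE big_map.
by apply: perm_big; rewrite perm_sort.
Qed.

Lemma is_matchingP (T : {fset word * word}) :
  reflect (forall e f, e \in T -> f \in T ->
             e.1 = f.1 \/ e.2 = f.2 -> e = f) (is_matching T).
Proof.
apply: (iffP forallP) => [h e f eT fT|h e].
  have /forallP /(_ [` fT]%fset) /implyP /= := h [` eT]%fset.
  move=> k ef; suff /eqP/(congr1 val) : [` eT]%fset == [` fT]%fset by [].
  by apply: k; case: ef => ->; rewrite eqxx ?orbT.
apply/forallP => f; apply/implyP => ef; apply/eqP/val_inj; apply: h.
- exact: fsvalP.
- exact: fsvalP.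
- by case/orP: ef => /eqP; [left|right].
Qed.

Lemma mem_matchings T A B :
  (T \in matchings A B) = (T `<=` A `*` B)%fset && is_matching T.
Proof. by rewrite mem_filter fpowersetE andbC. Qed.

Lemma mem_Fset_sub a w x : w \in Fset a -> x \in w -> x \in a.
Proof.
rewrite mem_Fset => wa xw; rewrite -(flatten_LR a); apply/flattenP.
by exists w; first by rewrite mem_rev.
Qed.

Lemma count_join P (a b : pf) T :
  T \in matchings (Fset a) (Fshift b (size a)) ->
  count P (join a b T) = count P (a ++ shiftw b (size a)).
Proof.
rewrite mem_matchings => /andP[/fsubsetP sT /is_matchingP mT].
set A := Fset a; set m := size a; set B := Fshift b m.
have loA w x : w \in A -> x \in w -> (x <= m)%N.
  move=> wA /(mem_Fset_sub wA) xa.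
  by have /andP[/allP /(_ x xa) /andP[]] := pfP a.
have hiB w x : w \in B -> x \in w -> (m < x)%N.
  move=> /imfsetP[v /= vb ->] /mapP[y yv ->].
  have /andP[/allP /(_ y (mem_Fset_sub vb yv)) /andP[y0 _] _] := pfP b; lia.
have nA w : w \in A -> w != [::].
  by rewrite mem_Fset => h; apply/eqP => w0; have := LR_nonnil a; rewrite -w0 h.
have nB w : w \in B -> w != [::].
  move=> /imfsetP[v /=]; rewrite mem_Fset => h ->; apply/eqP => /(congr1 size).
  by rewrite size_map => /size0nil v0; have := LR_nonnil b; rewrite -v0 h.
have AB : [disjoint A & B]%fset.
  apply/fdisjointP => w wA; apply/negP => wB.
  case: w wA wB (nA w) => [|x w] wA wB; first by move/(_ wA).
  by have := loA _ x wA (mem_head _ _); have := hiB _ x wB (mem_head _ _); lia.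
have TE e : e \in T -> e.1 \in A /\ e.2 \in B.
  by move=> /sT; rewrite in_fsetM => /andP.
have fst_inj : {in T &, injective (fun e : word * word => e.1)}.
  by move=> e f eT fT h; apply: mT => //; left.
have snd_inj : {in T &, injective (fun e : word * word => e.2)}.
  by move=> e f eT fT h; apply: mT => //; right.
have cat_inj : {in T &, injective (fun e : word * word => e.1 ++ e.2)}.
  move=> e f /[dup] eT /TE[e1 e2] /[dup] fT /TE[f1 f2] /= h; apply: mT => //; left.
  have fl (g : word * word) : g.1 \in A -> g.2 \in B ->
      [seq x <- g.1 ++ g.2 | x <= m]%N = g.1.
    move=> g1 g2; rewrite filter_cat.
    have /all_filterP -> : all (fun x => x <= m)%N g.1.
      by apply/allP => x; apply: loA g1.
    suff -> : [seq x <- g.2 | x <= m]%N = [::] by rewrite cats0.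
    apply/eqP; rewrite -(negbK (_ == _)) -has_filter; apply/hasPn => x xg.
    by rewrite -ltnNge; apply: hiB g2 xg.
  by rewrite -(fl e) // -(fl f) // h.
rewrite /join count_wcat -/A -/B /joinF.
set E1 := [fset e.1 | e in T]%fset; set E2 := [fset e.2 | e in T]%fset.
set C := [fset e.1 ++ e.2 | e in T]%fset.
have sE1 : (E1 `<=` A)%fset.
  by apply/fsubsetP => w /imfsetP[e /= /TE[? _] ->].
have sE2 : (E2 `<=` B)%fset.
  by apply/fsubsetP => w /imfsetP[e /= /TE[_ ?] ->].
have dC : [disjoint ((A `|` B) `\` (E1 `|` E2)) & C]%fset.
  apply/fdisjointP => w; rewrite in_fsetD !in_fsetU => /andP[_ wAB].
  apply/negP => /imfsetP[e /= /TE[e1 e2] we].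
  case E : e.1 e1 (nA _ e1) we => [//|x u] e1 _ we.
  case F : e.2 e2 (nB _ e2) we => [//|y v] e2 _ we.
  have xw : x \in w by rewrite we mem_head.
  have yw : y \in w by rewrite we mem_cat mem_head orbT.
  have := loA _ x e1 (mem_head _ _); have := hiB _ y e2 (mem_head _ _).
  by case/orP: wAB => h; [have := loA _ _ h yw|have := hiB _ _ h xw]; lia.
have big_split_fset (X Y : {fset word}) (F : word -> nat) : [disjoint X & Y]%fset ->
    (\sum_(w <- (X `|` Y)%fset) F w = \sum_(w <- X) F w + \sum_(w <- Y) F w)%N.
  move=> d; rewrite -big_cat /=; apply: perm_big; apply: uniq_perm.
  - exact: fset_uniq.
  - rewrite cat_uniq !fset_uniq andbT /=; apply/hasPn => w wY.
    by apply/negP => wX; have /fdisjointP /(_ w wX) := d; rewrite wY.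
  - by move=> w; rewrite mem_cat in_fsetU.
have CE : (\sum_(w <- C) count P w = \sum_(e <- T) count P (e.1 ++ e.2))%N.
  by rewrite /C big_imfset.
have E1E : (\sum_(w <- E1) count P w = \sum_(e <- T) count P e.1)%N.
  by rewrite /E1 big_imfset.
have E2E : (\sum_(w <- E2) count P w = \sum_(e <- T) count P e.2)%N.
  by rewrite /E2 big_imfset.
rewrite big_split_fset // CE.
have -> : (\sum_(e <- T) count P (e.1 ++ e.2) =
           \sum_(w <- (E1 `|` E2)%fset) count P w)%N.
  rewrite big_split_fset; last first.
    by apply/fdisjointP => w /(fsubsetP sE1) wA;
       apply: contra (fdisjointP AB w wA); apply: (fsubsetP sE2).
  rewrite E1E E2E -big_split /=.
  by apply: eq_bigr => e _; rewrite count_cat.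
rewrite -big_split_fset; last first.
  by apply/fdisjointP => w; rewrite in_fsetD => /andP[].
rewrite (_ : _ `|` _ = A `|` B)%fset; last first.
  apply/fsetP => w; rewrite !in_fsetU in_fsetD !in_fsetU.
  case w1 : (w \in E1); first by rewrite (fsubsetP sE1).
  case w2 : (w \in E2); first by rewrite (fsubsetP sE2) ?orbT.
  by rewrite /= !orbF.
rewrite big_split_fset // count_cat -count_Fset; congr addn.
rewrite /B /Fshift big_imfset /=; last first.
  by move=> u v _ _; apply: inj_map => x y; lia.
rewrite /shiftw count_map -count_Fset; apply: eq_bigr => w _.
by rewrite count_map.
Qed.

Lemma join_is_pf (a b : pf) T :
  T \in matchings (Fset a) (Fshift b (size a)) -> is_pf (join a b T).
Proof.
move=> h; rewrite (@is_pf_perm _ (a ++ shiftw b (size a))).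
  by apply: is_pf_cat; apply: pfP.
by apply/seq.permP => P; apply: count_join.
Qed.

Definition slash (a b : pf) : pf := to_pf (shiftw b (size a) ++ a).

Lemma val_slash (a b : pf) : pfw (slash a b) = shiftw b (size a) ++ a.
Proof.
have h : is_pf (shiftw b (size a) ++ a).
  rewrite (@is_pf_perm _ (a ++ shiftw b (size a))).
    by apply: is_pf_cat; apply: pfP.
  by rewrite perm_catC.
by rewrite /slash /to_pf -[LHS]/(val _) insubdK.
Qed.

Definition atomic (a : pf) : Prop :=
  a <> pf_eps /\
  ~ (exists b c : pf, [/\ b <> pf_eps, c <> pf_eps & a = slash b c]).

Definition atomic_pf := {a : pf | `[< atomic a >]}.

Definition covered_by (a b : pf) : Prop :=
  let F := LR a in
  exists i j, [/\ (i < j)%N, (j < size F)%N,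
    (forall x y, x \in nth [::] F i -> y \in nth [::] F j -> (x <= y)%N)
    & LR b = take i F ++ (nth [::] F i ++ nth [::] F j)
               :: drop i.+1 (take j F) ++ drop j.+1 F].

Definition pf_le : pf -> pf -> Prop := clos_refl_trans pf covered_by.

(* Subwords as words: equal words at different places are not distinguished. *)
Definition subwords (a : word) : seq word :=
  undup [seq mask m a | m : (size a).-tuple bool].

Definition splits (a : word) : seq (word * word) :=
  [seq x <- [seq (u, v) | u <- subwords a, v <- subwords a]
    | (Fset x.1 `&` Fset x.2 == fset0)%fset &&
      (Fset x.1 `|` Fset x.2 == Fset a)%fset].

Definition Park (w : word) : pf := to_pf (park w).

Lemma val_Park (a : pf) x : x \in splits a ->
  pfw (Park x.1) = park x.1 /\ pfw (Park x.2) = park x.2.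
Proof.
have sub w : w \in subwords a -> is_pf (park w).
  rewrite mem_undup => /mapP[m _ ->]; apply: park_is_pf => y /mem_mask ya.
  by have /andP[/allP /(_ y ya) /andP[]] := pfP a.
rewrite mem_filter => /andP[_] /allpairsP[[u v] [/sub hu /sub hv ->]].
by rewrite /Park /to_pf; split; rewrite -[LHS]/(val _) insubdK.
Qed.

Notation PFSym K := {malg K[pf]}.

(* PFSym (x) PFSym, on the basis of the M_a (x) M_b *)
Notation PFSym2 K := {malg K[(pf * pf)%type]}.

Section Algebra.
Variable K : fieldType.

Definition linext (I : choiceType) (V : lmodType K) (e : I -> V)
    (x : {malg K[I]}) : V :=
  \sum_(i <- msupp x) x@_i *: e i.

Definition is_basis (I : choiceType) (V : lmodType K) (e : I -> V) : Prop :=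
  bijective (linext e).

Definition M (a : pf) : PFSym K := << a >>.

Definition tensor (x y : PFSym K) : PFSym2 K :=
  linext (fun a => linext (fun b => << (a, b) >> : PFSym2 K) y) x.

Definition starM (a b : pf) : PFSym K :=
  if a == pf_eps then M b else if b == pf_eps then M a else
  \sum_(T <- matchings (Fset a) (Fshift b (size a))) M (to_pf (join a b T)).

Definition star (x y : PFSym K) : PFSym K :=
  linext (fun a => linext (fun b => starM a b) y) x.

Definition DeltaM (a : pf) : PFSym2 K :=
  \sum_(x <- splits a) tensor (M (Park x.1)) (M (Park x.2)).

Definition Delta (x : PFSym K) : PFSym2 K := linext DeltaM x.

Definition Q (a : pf) : PFSym K :=
  \sum_(b <- Pn (size a) | `[< pf_le a b >]) M b.

(* The algebra morphism from the free associative algebra K<I> = K[fmonom I]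
   (fmonom I is the free monoid) to (PFSym, star, M_epsilon) extending e exists
   and is an isomorphism. *)
Definition freely_generates (I : choiceType) (e : I -> PFSym K) : Prop :=
  exists phi : {linear {malg K[{fmonom I}]} -> PFSym K},
    [/\ phi 1 = M pf_eps,
        forall x y, phi (x * y) = star (phi x) (phi y),
        forall i, phi << fmu i >> = e i
      & bijective phi].

End Algebra.

(* Main.v *)
Require Import Defs.
From HB Require Import structures.
From mathcomp Require Import all_boot all_algebra finmap boolp monalg zify.
From Stdlib Require Import Relations.
Set Implicit Arguments.
Unset Strict Implicit.
Unset Printing Implicit Defensive.
Import GRing.Theory.

(** Write [F_b] for the LR-decomposition of [b]. The order has a global
    description: [a <=* b] iff the words of [F_b] are concatenations of chains
    of words of [F_a] (weakly increasing letters from one word to the next),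
    each word of [F_a] being used once. As the words of [F_a] have distinct first
    letters, this grouping is determined by [b].

    Product: if [c] lies above [a|b], cutting each word of [F_c] after its letters
    that are at most [m] gives decompositions of some [a' >= a] and of a shift of
    some [b' >= b], and the words cut into two nonempty parts form the matching.
    So the terms of [Q_a * Q_b] are those of [Q_(a|b)], each occurring once.
    Coproduct: a splitting of [F_b], for [b >= a], is the same as a splitting
    [(a', a'')] of [F_a] with coarsenings of [a'] and of [a'']; and parkization is
    the inverse of an increasing relabelling, so it commutes with coarsening.
    Basis: [Q_a] is [M_a] plus terms [M_b] where [F_b] has fewer words than [F_a].
    Freeness: slash factorization into atomic parking functions is unique, since
    of two left factors of the same parking function one divides the other. *)

(** * Linear extension and unitriangular families *)

Local Open Scope ring_scope.

Section Linext.
Variables (K : fieldType) (I : choiceType) (V : lmodType K).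
Implicit Types (e : I -> V) (x : {malg K[I]}).

Lemma linextEw e x (D : {fset I}) : (msupp x `<=` D)%fset ->
  linext e x = \sum_(i <- D) x@_i *: e i.
Proof.
move=> h; rewrite /linext (big_fset_incl _ h) // => i _ /mcoeff_outdom ->.
by rewrite scale0r.
Qed.

Lemma linext_is_linear e : linear (linext e).
Proof.
move=> c x y; pose D := (msupp x `|` msupp y)%fset.
have hx : (msupp x `<=` D)%fset by apply: fsubsetUl.
have hy : (msupp y `<=` D)%fset by apply: fsubsetUr.
have hxy : (msupp (c *: x + y) `<=` D)%fset.
  by apply: fsubset_trans (msuppD_le _ _) (fsetSU _ (msuppZ_le _ _)).
rewrite (linextEw _ hx) (linextEw _ hy) (linextEw _ hxy) scaler_sumr -big_split.
by apply: eq_bigr => i _; rewrite mcoeffD mcoeffZ scalerDl scalerA.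
Qed.

HB.instance Definition _ e :=
  GRing.isLinear.Build K {malg K[I]} V _ (linext e) (linext_is_linear e).

Lemma linextU e i : linext e << i >> = e i.
Proof. by rewrite /linext msuppU oner_eq0 big_seq_fset1 mcoeffUU scale1r. Qed.

End Linext.

Lemma malgUZ (K : fieldType) (I : choiceType) (c : K) (i : I) :
  << c *g i >> = c *: << i >> :> {malg K[I]}.
Proof. by apply/malgP => j; rewrite mcoeffZ !mcoeffU mulrnAr mulr1. Qed.

Lemma malg_sum (K : fieldType) (I : choiceType) (x : {malg K[I]}) :
  x = \sum_(i <- msupp x) x@_i *: << i >>.
Proof. by rewrite {1}[x]monalgE; apply: eq_bigr => i _; rewrite malgUZ. Qed.

Lemma linext_comp (K : fieldType) (I J : choiceType) (V : lmodType K)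
    (e : I -> {malg K[J]}) (f : J -> V) x :
  linext f (linext e x) = linext (fun i => linext f (e i)) x.
Proof.
by rewrite [linext e x]/linext linear_sum; apply: eq_bigr => i _; rewrite linearZ.
Qed.

Lemma linext_id (K : fieldType) (I : choiceType) (x : {malg K[I]}) :
  linext (fun i => << i >> : {malg K[I]}) x = x.
Proof. by rewrite [RHS]malg_sum. Qed.

Lemma linext2_sum (K : fieldType) (I J : choiceType) (V : lmodType K)
    (e : I -> J -> V) (A B : Type) (r : seq A) (s : seq B) F G :
  linext (fun a => linext (e a) (\sum_(j <- s) << G j >>)) (\sum_(i <- r) << F i >>)
  = \sum_(i <- r) \sum_(j <- s) e (F i) (G j).
Proof.
rewrite linear_sum /=; apply: eq_bigr => i _; rewrite linextU linear_sum /=.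
by apply: eq_bigr => j _; rewrite linextU.
Qed.

(** Exchange of two finite sums. It gives linearity of [star] in its second argument, as [star]
    expands its first argument outermost. *)
Lemma linext2C (K : fieldType) (I J : choiceType) (V : lmodType K)
    (e : I -> J -> V) x y :
  linext (fun a => linext (e a) y) x = linext (fun b => linext (e^~ b) x) y.
Proof.
rewrite /linext; under eq_bigr do rewrite scaler_sumr.
rewrite exchange_big; apply: eq_bigr => j _; rewrite scaler_sumr.
by apply: eq_bigr => i _; rewrite !scalerA mulrC.
Qed.

(** The extension of [e \o p] is the extension of [e] after a relabelling [P] of basis vectors,
    which the inverse [q] undoes. It later moves the basis of the [Q a] to the free monoid. *)
Lemma reindex_linext_bij (K : fieldType) (I J : choiceType) (V : lmodType K)
    (p : I -> J) (e : J -> V) :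
  bijective p -> is_basis e -> is_basis (e \o p).
Proof.
move=> [q pK qK] [g eK gK].
pose P := linext (fun i => << p i >> : {malg K[J]}).
pose P' := linext (fun j => << q j >> : {malg K[I]}).
have E x : linext (e \o p) x = linext e (P x).
  by rewrite linext_comp; congr linext; apply/funext => i; rewrite linextU.
exists (P' \o g) => [x|y] /=.
  rewrite E eK /P /P' linext_comp -[RHS]linext_id; congr linext; apply/funext => i.
  by rewrite linextU pK.
rewrite E -[RHS]gK; congr linext.
rewrite /P /P' linext_comp -[RHS]linext_id; congr linext; apply/funext => i.
by rewrite linextU qK.
Qed.

Section Unitriangular.
Variables (K : fieldType) (I : choiceType) (e : I -> {malg K[I]}).
Variables (s : I -> seq I) (rk : I -> nat).
Hypothesis eE : forall a, e a = << a >> + \sum_(b <- s a) << b >>.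
Hypothesis rk_lt : forall a b, b \in s a -> (rk b < rk a)%N.

(** Back substitution with fuel [n]. The value 0 at empty fuel is never reached from [rk a < n],
    because the rank drops at each call. *)
Fixpoint triinv_rec n a : {malg K[I]} :=
  if n is n'.+1 then << a >> - \sum_(b <- s a) triinv_rec n' b else 0.

Definition triinv a := triinv_rec (rk a).+1 a.

Lemma triinv_recE n a : (rk a < n)%N -> triinv_rec n a = triinv a.
Proof.
suff H m k b : (rk b < m)%N -> (rk b < k)%N -> triinv_rec m b = triinv_rec k b.
  by move=> h; apply: H.
elim: m k b => [|m IH] [|k] b //= hm hk; congr (_ - _).
by apply: eq_big_seq => c /rk_lt hc; apply: IH; lia.
Qed.

Lemma triinvE a : triinv a = << a >> - \sum_(b <- s a) triinv b.
Proof.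
rewrite {1}/triinv /=; congr (_ - _).
by apply: eq_big_seq => b /rk_lt h; apply: triinv_recE.
Qed.

(** The inverse is [linext triinv]. One composite telescopes at once by [triinvE]; the other needs
    induction on the rank. *)
Lemma unitriangular_basis : is_basis e.
Proof.
exists (linext triinv) => x; rewrite linext_comp -[RHS]linext_id;
  congr linext; apply/funext => a.
  rewrite eE linearD linear_sum /= linextU triinvE.
  by under eq_bigr do rewrite linextU; rewrite subrK.
have [n] := ubnP (rk a); elim: n a => // n IH a ha.
have {}IH : \sum_(b <- s a) linext e (triinv b) = \sum_(b <- s a) << b >>.
  by apply: eq_big_seq => b /rk_lt hb; apply: IH; lia.
by rewrite triinvE linearB (linear_sum (linext e)) /= linextU eE IH addrK.
Qed.

End Unitriangular.

(** * LR-decompositions *)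

Local Open Scope nat_scope.

Notation heads := (map (head 0)).

Definition headmin (w : word) : bool := (w != [::]) && all (leq (head 0 w)) w.

(** These are, up to order, the LR-decompositions: see [lrset_LR] and [LR_lrcat]. *)
Definition lrset (s : seq word) : bool := all headmin s && uniq (heads s).

(** Since [w] begins with its minimum, position 0 is its only left-to-right minimum. A left-to-right
    minimum of [a] is at most the head of [a], hence below every letter of [w]. *)
Lemma lrpos_cat w a : headmin w -> (a == [::]) || (head 0 a < head 0 w) ->
  lrpos (w ++ a) = 0 :: map (addn (size w)) (lrpos a).
Proof.
case: w => // x w /andP[_ hm] ha; rewrite /lrpos size_cat iotaD filter_cat /=.
have h0 i : i < size (x :: w) -> x <= nth 0 (x :: w) i.
  by move=> h; apply: (allP hm); apply: mem_nth.
rewrite (_ : filter _ (iota 1 _) = [::]) /=; last first.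
  apply/eqP; rewrite -(negbK (_ == _)) -has_filter; apply/hasPn => i.
  rewrite mem_iota => hi; apply/negP => /allP /(_ 0).
  rewrite mem_iota => /(_ ltac:(lia)); rewrite -[x :: _]/((x :: w) ++ a) nth_cat /=.
  by rewrite ifT; [have := h0 i; move=> /=; lia|lia].
congr cons; rewrite add0n -[(size w).+1]addn0 iotaDl filter_map addn0; congr map.
apply: eq_in_filter => i; rewrite mem_iota => hi.
have E k : nth 0 (x :: w ++ a) ((size w).+1 + k) = nth 0 a k.
  by rewrite -[x :: _]/((x :: w) ++ a) nth_cat /=; case: ltnP => [|_]; [lia|congr nth; lia].
rewrite /=; apply/allP/allP => h j; rewrite mem_iota => hj.
  have := h ((size w).+1 + j); rewrite mem_iota !E; apply; lia.
rewrite E; case: (ltnP j (size w).+1) => hjw; last first.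
  rewrite -(subnKC hjw) E; apply: h; rewrite mem_iota; lia.
rewrite -[x :: _]/((x :: w) ++ a) nth_cat hjw.
(* Chain of inequalities: the letter of [a] at [i] is at most the head of [a], which is below [x],
   which is at most every letter of the first factor. *)
apply: leq_trans (h0 _ hjw).
case: a ha hi h {E} => [|y a] /=; first by lia.
case: i hj => [|i] // _ lt _ /(_ 0); rewrite mem_iota /= => h.
by have := h isT; lia.
Qed.

Lemma LR_cat w a : headmin w -> (a == [::]) || (head 0 a < head 0 w) ->
  LR (w ++ a) = rcons (LR a) w.
Proof.
move=> hw ha; rewrite /LR lrpos_cat //= -rev_cons; congr rev.
have sh s : drop (size w) (take (size w + s) (w ++ a)) = take s a.
  by rewrite take_cat ltnNge leq_addr /= addKn drop_size_cat.
have shp p : drop (size w + p.1) (take (size w + p.2) (w ++ a)) =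
             drop p.1 (take p.2 a).
  by rewrite addnC -drop_drop sh.
case: (posnP (size a)) => [/size0nil -> /=|/lrpos_cons[ps ->] /=].
  by rewrite cats0 drop0 take_size.
rewrite addn0 drop0 take_size_cat //; congr cons.
have zipM s t : zip (map (addn (size w)) s) (map (addn (size w)) t) =
    [seq (size w + p.1, size w + p.2) | p <- zip s t].
  by elim: s t => [|y s IH] [|z t] //=; rewrite IH.
rewrite -{1}[size w]addn0 -map_cons size_cat -map_rcons zipM.
by rewrite -map_comp; apply: eq_map => p /=; rewrite shp.
Qed.

Lemma sorted_LR a : sorted ltn (heads (LR a)).
Proof.
rewrite -rev_sorted -map_rev heads_LR sorted_map.
apply: (sub_in_sorted (e := ltn) (P := mem (lrpos a))); last exact: lrpos_sorted.
  move=> i j _ jp ij /=.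
  have {jp} : j \in lrpos a by []; rewrite mem_filter => /andP[/allP mj _].
  by apply: mj; rewrite mem_iota.
exact/allP.
Qed.

Lemma headmin_LR a : all headmin (LR a).
Proof.
have [n] := ubnP (size a); elim: n a => // n IH [|x a] // /= ha.
(* The word is cut before its first letter smaller than [x]; without such a letter the second factor
   is empty. *)
rewrite -(cat_take_drop (find (gtn x) a) a) -cat_cons LR_cat /=.
- rewrite all_rcons IH ?size_drop ?andbT; last by lia.
  apply/andP; split=> //=; rewrite leqnn /=; apply/(all_nthP 0) => i.
  rewrite size_take_min leq_min => /andP[hi _]; rewrite nth_take // leqNgt.
  by have /= -> := before_find 0 hi.
- apply/andP; split=> //=; rewrite leqnn /=; apply/(all_nthP 0) => i.
  rewrite size_take_min leq_min => /andP[hi _]; rewrite nth_take // leqNgt.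
  by have /= -> := before_find 0 hi.
- case: (boolP (has (gtn x) a)) => h.
    by rewrite orbC -nth0 nth_drop addn0; have /= -> := nth_find 0 h.
  by rewrite (hasNfind h) drop_size.
Qed.

(** Induction on the last entry of [s], which is the first factor of the word; [LR_cat] peels it
    off. *)
Lemma LR_flatten_rev s : all headmin s -> sorted ltn (heads s) ->
  LR (flatten (rev s)) = s.
Proof.
elim/last_ind: s => // s w IH; rewrite all_rcons => /andP[hw hs].
rewrite map_rcons => so; rewrite rev_rcons /=.
have {}IH : LR (flatten (rev s)) = s.
  apply: IH => //; move: so; rewrite -cats1 => /cat_sorted2[] //.
rewrite LR_cat ?IH //; case/lastP: s hs so {IH} => [//|s v].
rewrite all_rcons => /andP[/andP[v0 _] _] so.
rewrite rev_rcons /=; case: v v0 so => // x v _ so /=.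
move: so; rewrite map_rcons -!cats1 -catA /= => /cat_sorted2[_] /=.
by rewrite andbT.
Qed.

Lemma lrset_perm s t : perm_eq s t -> lrset s = lrset t.
Proof. by move=> h; rewrite /lrset (perm_all _ h) (perm_uniq (perm_map _ h)). Qed.

Lemma lrset_LR a : lrset (LR a).
Proof.
rewrite /lrset headmin_LR /=.
by apply: sorted_uniq (sorted_LR a); [apply: ltn_trans|apply: ltnn].
Qed.

Lemma lrset_uniq s : lrset s -> uniq s.
Proof. by move=> /andP[_]; apply: map_uniq. Qed.

(** A strictly sorted list is determined by its members. From here on LR-decompositions are compared
    only up to permutation. *)
Lemma sorted_heads_perm s t : sorted ltn (heads s) -> sorted ltn (heads t) ->
  perm_eq s t -> s = t.
Proof.
rewrite !sorted_map => ss st h; apply: irr_sorted_eq ss st (perm_mem h).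
  by move=> v u w; apply: ltn_trans.
by move=> u; apply: ltnn.
Qed.

Lemma LR_perm_inj a b : perm_eq (LR a) (LR b) -> a = b.
Proof.
move=> /(sorted_heads_perm (sorted_LR a) (sorted_LR b)) h.
by rewrite -[a]flatten_LR h flatten_LR.
Qed.

(** The formula of [wcat], on lists instead of finite sets, so that it can be applied to
    concatenated lists of groups. *)
Definition lrcat (s : seq word) : word :=
  flatten (sort (fun u v : word => head 0 v <= head 0 u) s).

Lemma LR_lrcat s : lrset s -> perm_eq (LR (lrcat s)) s.
Proof.
move=> /andP[hs us]; rewrite /lrcat; set r := fun u v : word => _.
have pt : perm_eq (rev (sort r s)) s by rewrite perm_rev perm_sort.
rewrite -[sort r s]revK LR_flatten_rev //; first by rewrite (perm_all _ pt).
rewrite sorted_map rev_sorted.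
have : sorted (fun u v => head 0 v <= head 0 u) (sort r s).
  by apply: sort_sorted => u v; apply: leq_total.
have : uniq (heads (sort r s)) by rewrite (perm_uniq (perm_map _ (permEl (perm_sort r s)))).
elim: (sort r s) => //= u [|v t] //= IH /andP[nu h] /andP[le so].
rewrite IH // andbT ltn_neqAle le andbT; apply: contra nu => /eqP ->.
exact: mem_head.
Qed.

Lemma lrcat_LR a : lrcat (LR a) = a.
Proof. exact/LR_perm_inj/LR_lrcat/lrset_LR. Qed.

Lemma lrcat_perm s t : lrset s -> perm_eq s t -> lrcat s = lrcat t.
Proof.
move=> hs h; apply: LR_perm_inj; rewrite (permPl (LR_lrcat hs)).
by rewrite perm_sym (permPl (LR_lrcat _)) -?(lrset_perm h) // perm_sym.
Qed.

Lemma perm_lrcat s : perm_eq (lrcat s) (flatten s).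
Proof. by apply: perm_flatten; rewrite perm_sort. Qed.

Lemma perm_flatten_LR a : perm_eq (flatten (LR a)) a.
Proof. by rewrite -{2}(lrcat_LR a) perm_sym perm_lrcat. Qed.

Definition wle (u v : word) : bool := all (fun x => all (leq x) v) u.

Lemma wleP u v : reflect (forall x y, x \in u -> y \in v -> x <= y) (wle u v).
Proof.
apply: (iffP allP) => [h x y xu yv|h x xu]; first exact: (allP (h x xu)).
by apply/allP => y; apply: h.
Qed.

(** [X] lists the groups: each is a chain of words of [s], and its concatenation is a word of [t].
    Words in a chain are compared pairwise because [wle] is not transitive through the empty word.
    An empty group is possible only if [t] contains the empty word. *)
Definition coarsens (X : seq (seq word)) (s t : seq word) : bool :=
  [&& perm_eq (flatten X) s, perm_eq (map flatten X) t & all (pairwise wle) X].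

Definition coarser (a b : word) : Prop := exists X, coarsens X (LR a) (LR b).

(** The head of a chain is the head of its first word, which is its minimum as the later words are
    weakly larger. So the heads of the groups form a subsequence of the old heads and stay
    distinct. *)
Lemma lrset_coarsens X s t : coarsens X s t -> lrset s -> [::] \notin t -> lrset t.
Proof.
move=> /and3P[h1 h2 h3] hs t0; rewrite -(lrset_perm h2); rewrite -(lrset_perm h1) in hs.
have {t0 h2} : [::] \notin X.
  by apply: contra t0 => /(map_f flatten); rewrite (perm_mem h2).
move=> X0; have /andP[hd us] := hs; apply/andP; split.
  apply/allP => w /mapP[x xX ->]; have := allP h3 _ xX.
  have : all headmin x by apply/allP => u ux; apply: (allP hd); apply/flattenP; exists x.
  have : x != [::] by apply: contra X0 => /eqP <-.
  case: x {xX} => // u x _ /= /andP[/andP[u0 hu] _] /andP[ux _].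
  apply/andP; split; first by case: u u0 {hu ux}.
  rewrite (_ : head 0 (u ++ _) = head 0 u); last by case: u u0 {hu ux}.
  rewrite all_cat hu /=; apply/allP => y /flattenP[v vx yv].
  have /wleP := allP ux v vx; apply=> //.
  by case: u u0 {hu ux} => // x0 u _; apply: mem_head.
suff : subseq (heads (map flatten X)) (heads (flatten X)) by move=> /subseq_uniq; apply.
have : all (all headmin) X.
  by apply/allP => x xX; apply/allP => u ux; apply: (allP hd); apply/flattenP; exists x.
elim: X X0 {h1 h3 hs hd us} => // -[|u x] X IH //; rewrite inE negb_or => /andP[_ X0].
move=> /= /andP[/andP[/andP[u0 _] _] hX].
rewrite (_ : head 0 (u ++ _) = head 0 u); last by case: u u0.
rewrite eqxx map_cat; apply: subseq_trans (IH X0 hX) _; exact: suffix_subseq.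
Qed.

(** * The order as grouping into chains *)

Lemma headmin_nonnil w : headmin w -> w != [::].
Proof. by case/andP. Qed.

Lemma head_catl (u v : word) : u != [::] -> head 0 (u ++ v) = head 0 u.
Proof. by case: u. Qed.

Lemma mem_head_nonnil (u : word) : u != [::] -> head 0 u \in u.
Proof. by case: u => // x u _; apply: mem_head. Qed.

(** Used with [f := flatten] to extract from a grouping the group whose concatenation is a given
    word. *)
Lemma perm_map_cons (S T : eqType) (f : S -> T) (X : seq S) u R :
  perm_eq (map f X) (u :: R) ->
  exists x X', [/\ perm_eq X (x :: X'), f x = u & perm_eq (map f X') R].
Proof.
move=> h; have : u \in map f X by rewrite (perm_mem h) mem_head.
move=> /mapP[x xX ux]; exists x, (rem x X); rewrite perm_to_rem //; split=> //.
by rewrite -(perm_cons u) {1}ux -map_cons -(permPr h) perm_map // perm_sym perm_to_rem.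
Qed.

Lemma coarsens_perm X Y s t s' t' : perm_eq X Y -> perm_eq s s' -> perm_eq t t' ->
  coarsens X s t = coarsens Y s' t'.
Proof.
move=> h hs ht; rewrite /coarsens (perm_all _ h) (permPr hs) (permPr ht).
by rewrite (permPl (perm_flatten h)) (permPl (perm_map _ h)).
Qed.

Lemma coarser_lrset a t X : coarsens X (LR a) t -> [::] \notin t ->
  lrset t /\ coarser a (lrcat t).
Proof.
move=> h t0; have ht := lrset_coarsens h (lrset_LR a) t0; split=> //; exists X.
by rewrite (coarsens_perm (perm_refl X) (perm_refl (LR a)) (LR_lrcat ht)).
Qed.

Lemma coarser_perm a b : coarser a b -> perm_eq a b.
Proof.
move=> [X /and3P[h1 h2 _]]; rewrite -(permPl (perm_flatten_LR a)).
rewrite -(permPl (perm_flatten h1)) -(permPr (perm_flatten_LR b)).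
rewrite -(permPr (perm_flatten h2)).
by elim: X {h1 h2} => //= x X IH; rewrite flatten_cat perm_cat2l.
Qed.

Lemma coarser_refl a : coarser a a.
Proof.
exists [seq [:: w] | w <- LR a]; apply/and3P; split.
- by rewrite flatten_seq1.
- by rewrite -map_comp; rewrite (eq_map (g := id)) ?map_id // => w /=; rewrite cats0.
- by apply/allP => x /mapP[w _ ->].
Qed.

Lemma take_nth_drop2 (T : Type) (x0 : T) s i j : i < j -> j < size s ->
  s = take i s ++ (nth x0 s i :: drop i.+1 (take j s)) ++ (nth x0 s j :: drop j.+1 s).
Proof.
move=> ij js; rewrite -{1}(cat_take_drop j s) (drop_nth x0 js) catA; congr cat.
rewrite -{1}(cat_take_drop i (take j s)) take_takel ?(ltnW ij) //; congr cat.
by rewrite (drop_nth x0) ?nth_take // size_takel // ltnW.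
Qed.

(** Replaces positions by a statement up to permutation. This is harmless: heads are distinct, so
    [wle u v] forces [u] to stand before [v], and [u ++ v] keeps the head of [u], hence its
    place. *)
Lemma covered_byP (a b : pf) : covered_by a b <->
  exists u v R, [/\ perm_eq (LR a) (u :: v :: R), wle u v &
                    perm_eq (LR b) ((u ++ v) :: R)].
Proof.
split=> [[i [j [ij jF uv E]]]|[u [v [R [ha uv hb]]]]].
  set F := LR a in ij jF uv E.
  exists (nth [::] F i), (nth [::] F j).
  exists (take i F ++ drop i.+1 (take j F) ++ drop j.+1 F); split.
  - rewrite [X in perm_eq X _](take_nth_drop2 [::] ij jF).
    apply/seq.permP => p; rewrite /= ?count_cat /= ?count_cat /=; lia.
  - exact/wleP.
  - rewrite E; apply/seq.permP => p; rewrite /= ?count_cat /= ?count_cat /=; lia.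
have ok := lrset_LR a; have /and3P[hu hv hR] : all headmin (u :: v :: R).
  by rewrite -(perm_all _ ha); case/andP: ok.
set F := LR a in ha ok *.
have uF : u \in F by rewrite (perm_mem ha) mem_head.
have vF : v \in F by rewrite (perm_mem ha) !inE eqxx orbT.
have hh : head 0 u < head 0 v.
  have : uniq (heads (u :: v :: R)) by rewrite -(perm_uniq (perm_map _ ha)); case/andP: ok.
  rewrite /= inE negb_or ltn_neqAle -andbA => /andP[-> _] /=.
  by move/wleP: uv; apply; apply/mem_head_nonnil/headmin_nonnil.
set i := index u F; set j := index v F.
have iF : i < size F by rewrite index_mem.
have jF : j < size F by rewrite index_mem.
have Ei : nth [::] F i = u by apply: nth_index.
have Ej : nth [::] F j = v by apply: nth_index.
(* Heads increase along [LR a], so the inequality [hh] between heads decides the order of the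
   positions. *)
have ij : i < j.
  rewrite ltnNge; apply/negP => ji.
  have := sorted_leq_nth leq_trans leqnn 0 (s := heads F).
  rewrite (sub_sorted _ (sorted_LR a)); last by move=> x y /ltnW.
  move=> /(_ isT j i); rewrite !inE size_map iF jF => /(_ isT isT ji).
  by rewrite !(nth_map [::]) // Ei Ej leqNgt hh.
exists i, j; rewrite -/F Ei Ej; split=> //; first exact/wleP.
have EF : F = take i F ++ (u :: drop i.+1 (take j F)) ++ (v :: drop j.+1 F).
  by have := take_nth_drop2 [::] ij jF; rewrite Ei Ej.
(* Both lists have increasing heads: on the right, the heads are those of [F] with the head of [v]
   removed. Only a permutation remains to be shown. *)
apply: sorted_heads_perm; first exact: sorted_LR.
  have := sorted_LR a; rewrite -/F {1}EF => so.
  apply: (subseq_sorted ltn_trans _ so).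
  rewrite !map_cat; apply: cat_subseq => //; rewrite map_cons /=.
  rewrite head_catl ?headmin_nonnil // eqxx map_cat; apply: cat_subseq => //=; exact: subseq_cons.
rewrite (permPl hb) -cat1s -(perm_cat2l [:: u; v]).
have : perm_eq (u :: v :: R) (take i F ++ (u :: drop i.+1 (take j F)) ++ (v :: drop j.+1 F)).
  by rewrite -EF perm_sym.
move=> /seq.permP h; apply/seq.permP => p; have := h p.
by rewrite /= ?count_cat /= ?count_cat /=; lia.
Qed.

(** Induction along the covers, the last cover being added each time: gluing [u] and [v]
    concatenates the two groups that produce them, and [wle u v] compares the words of one with
    those of the other. *)
Lemma pf_le_coarser (a b : pf) : pf_le a b -> coarser a b.
Proof.
move=> /clos_rt_rtn1_iff; elim=> [|c d /covered_byP[u [v [R [hc uv hd]]]] _ [X hX]].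
  exact: coarser_refl.
have /and3P[h1 h2 h3] := hX.
have [xu [X1 [p1 eu q1]]] := perm_map_cons (perm_trans h2 hc).
have [xv [X2 [p2 ev q2]]] := perm_map_cons q1.
have pX : perm_eq X (xu :: xv :: X2) by rewrite (permPl p1) perm_cons.
exists ((xu ++ xv) :: X2); apply/and3P; split.
- by rewrite -(permPr h1) (permPr (perm_flatten pX)) /= catA.
- by rewrite (permPr hd) /= flatten_cat eu ev perm_cons.
- move: h3; rewrite (perm_all _ pX) /= pairwise_cat => /and3P[-> -> ->].
  rewrite !andbT; apply/allrelP => p q pu qv; apply/wleP => x y xp yq.
  move/wleP: uv; apply; first by rewrite -eu; apply/flattenP; exists p.
  by rewrite -ev; apply/flattenP; exists q.
Qed.

(** Induction on the number of words. If all groups have at most one word then [a = b]; otherwise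
    gluing the first two words of a larger group is a cover, and the rest of the grouping
    survives. *)
Lemma coarser_pf_le (a b : pf) : coarser a b -> pf_le a b.
Proof.
have [n] := ubnP (size (LR a)); elim: n a => // n IH a hn [X /and3P[h1 h2 h3]].
case: (boolP (all (fun x => size x <= 1) X)) => [hX|].
  suff -> : a = b by apply: rt_refl.
  apply/val_inj/LR_perm_inj; rewrite -(permPl h1) -(permPr h2).
  suff -> : flatten X = map flatten X by [].
  have : [::] \notin X.
    have := LR_nonnil b; apply: contra => /(map_f flatten).
    by rewrite (perm_mem h2).
  elim: X hX {h1 h2 h3} => //= -[|u [|v x]] X IHX //= hX.
  rewrite inE => h; rewrite IHX ?cats0 //.
case/allPn => x xX; case: x xX => [|u [|v x]] //= xX _.
have pX := perm_to_rem xX; set X' := rem _ X in pX.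
have ha : perm_eq (LR a) (u :: v :: (x ++ flatten X')).
  by rewrite -(permPl h1) (permPl (perm_flatten pX)).
have := h3; rewrite (perm_all _ pX) /= => /andP[/and3P[/andP[uv ux] vx px] hX'].
(* The LR-decomposition, up to order, of the intermediate word: only [u] and [v] are glued. *)
set t := (u ++ v) :: (x ++ flatten X').
have /and3P[hu hv hR] : all headmin (u :: v :: (x ++ flatten X')).
  by rewrite -(perm_all _ ha) headmin_LR.
have t0 : [::] \notin t.
  rewrite inE negb_or; apply/andP; split; first by rewrite eq_sym; case: (u) (headmin_nonnil hu).
  by apply/negP => /(allP hR).
have [ht ct] : lrset t /\ coarser a (lrcat t).
  apply: (@coarser_lrset _ _ ([:: u; v] :: map (fun w => [:: w]) (x ++ flatten X'))) => //.
  apply/and3P; split.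
  - by rewrite /= flatten_seq1 perm_sym.
  - rewrite /= cats0 perm_cons -map_comp.
    by rewrite (eq_map (g := id)) ?map_id // => w /=; rewrite cats0.
  - by rewrite /= uv /=; apply/allP => y /mapP[w _ ->].
have pfc : is_pf (lrcat t) by rewrite -(is_pf_perm (coarser_perm ct)) pfP.
apply: (@rt_trans _ _ _ (PF pfc)).
  apply: rt_step; apply/covered_byP; exists u, v, (x ++ flatten X'); split=> //.
  exact: LR_lrcat.
apply: IH.
  rewrite -ltnS; apply: leq_trans hn.
  by rewrite ltnS (perm_size ha) /= (perm_size (LR_lrcat ht)).
exists (((u ++ v) :: x) :: X'); apply/and3P; split.
- by rewrite perm_sym (permPl (LR_lrcat ht)).
- by rewrite -(permPr h2) (permPr (perm_map _ pX)) /= catA.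
- rewrite /= hX' px !andbT; apply/allP => w wx; apply/wleP => y z.
  rewrite mem_cat => /orP[]; apply/wleP; [exact: (allP ux)|exact: (allP vx)].
Qed.

(** Stated for arbitrary words, since it is also applied to shifted words and to subwords, which
    need not be parking functions. *)
Definition coarsenings (a : word) : seq word :=
  [seq b <- permutations a | `[< coarser a b >]].

Lemma mem_coarsenings a b : (b \in coarsenings a) = `[< coarser a b >].
Proof.
rewrite mem_filter andb_idr // mem_permutations => /asboolP /coarser_perm.
by rewrite perm_sym.
Qed.

Lemma coarsenings_uniq a : uniq (coarsenings a).
Proof. by rewrite filter_uniq // permutations_uniq. Qed.

Lemma pfw_to_pf w : is_pf w -> pfw (to_pf w) = w.
Proof. by move=> h; rewrite /to_pf -[LHS]/(val _) insubdK. Qed.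

Lemma pf_coarsening (a : pf) b : b \in coarsenings a -> is_pf b.
Proof.
by rewrite mem_coarsenings => /asboolP /coarser_perm /is_pf_perm <-; apply: pfP.
Qed.

Lemma Q_coarsenings (K : fieldType) (a : pf) :
  Q K a = (\sum_(b <- coarsenings a) << to_pf b >>)%R.
Proof.
rewrite /Q -(big_map to_pf xpredT (fun b => << b >>)%R) -[LHS]big_filter.
apply: perm_big.
apply: uniq_perm.
- by rewrite filter_uniq ?Pn_uniq.
- rewrite map_inj_in_uniq ?coarsenings_uniq // => b c /pf_coarsening hb /pf_coarsening hc.
  by move=> /(congr1 pfw); rewrite !pfw_to_pf.
- move=> b; rewrite mem_filter mem_Pn; apply/andP/mapP => [[/asboolP h _]|[c hc ->]].
    exists (pfw b); last by apply: val_inj; rewrite /= pfw_to_pf ?pfP.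
    by rewrite mem_coarsenings; apply/asboolP/pf_le_coarser.
  have pc := pf_coarsening hc; move: hc; rewrite mem_coarsenings => /asboolP hc.
  split; first by apply/asboolP/coarser_pf_le; rewrite pfw_to_pf.
  by rewrite pfw_to_pf // -(perm_size (coarser_perm hc)).
Qed.

(** * Increasing relabellings and parkization *)

Lemma pf_le_size_LR (a b : pf) : pf_le a b -> a = b \/ size (LR b) < size (LR a).
Proof.
move=> /clos_rt_rtn1_iff; elim=> [|c d /covered_byP[u [v [R [hc _ hd]]]] _ IH]; first by left.
right; have := perm_size hc; have := perm_size hd => /= h1 h2.
by case: IH => [->|h]; lia.
Qed.

(** Each cover lowers the number of words in the LR-decomposition, so this number is a rank for
    which the family is unitriangular. *)
Lemma Q_basis (K : fieldType) : is_basis (@Q K).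
Proof.
pose s (a : pf) := [seq b <- Pn (size a) | `[< pf_le a b >] && (b != a)].
apply: (@unitriangular_basis _ _ _ s (fun a : pf => size (LR a))) => [a|a b].
  rewrite /Q -big_filter (bigD1_seq a) ?filter_uniq ?Pn_uniq //=; last first.
    by rewrite mem_filter mem_Pn eqxx andbT; apply/asboolP/rt_refl.
  by rewrite big_filter_cond [RHS]/= big_filter.
rewrite mem_filter => /andP[/andP[/asboolP /pf_le_size_LR[->|//]]].
by rewrite eqxx.
Qed.

Section MonoMap.
Variables (g : nat -> nat).
Hypothesis gm : {mono g : x y / x <= y}.

Let gi : injective g := incn_inj gm.

Lemma headmin_map w : headmin w -> headmin (map g w).
Proof.
case: w => // x w /andP[_ /allP h]; apply/andP; split=> //.
by apply/allP => y /mapP[z zw ->]; rewrite gm; apply: h.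
Qed.

Lemma LR_map a : LR (map g a) = map (map g) (LR a).
Proof.
rewrite -{1}(flatten_LR a) map_flatten map_rev LR_flatten_rev //.
  by apply/allP => w /mapP[v va ->]; apply/headmin_map/(allP (headmin_LR a)).
rewrite (_ : heads _ = map g (heads (LR a))).
  by rewrite sorted_map; apply: sub_sorted (sorted_LR a) => x y /=; rewrite (leqW_mono gm).
by rewrite -!map_comp; apply/eq_in_map => -[|x w] // /(allP (headmin_LR a)).
Qed.

Lemma mono_can : exists h, cancel g h.
Proof.
have /choice[h hP] : forall y, exists x, forall z, g z = y -> z = x.
  move=> y; case: (pselect (exists x, g x = y)) => [[x <-]|h]; first by exists x => z /gi.
  (* Off the image of [g] the value 0 is arbitrary. *)
  by exists 0 => z zy; case: h; exists z.
by exists h => x; apply/esym/hP.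
Qed.

Lemma wle_map u v : wle (map g u) (map g v) = wle u v.
Proof.
rewrite /wle all_map; apply: eq_all => x /=; rewrite all_map.
by apply: eq_all => y /=; rewrite gm.
Qed.

(** A grouping is pushed forward letter by letter. Conversely it is pulled back along a left inverse
    of [g], all its words being images under [g]. *)
Lemma coarser_map a b : coarser (map g a) (map g b) <-> coarser a b.
Proof.
split=> -[X /and3P[h1 h2 h3]].
  have [h gK] := mono_can.
  have mK : cancel (map g) (map h) by apply: mapK.
  rewrite LR_map in h1; rewrite LR_map in h2.
  exists (map (map (map h)) X); apply/and3P; split.
  - by rewrite -map_flatten -[LR a](mapK mK) perm_map.
  - rewrite -map_comp (eq_map (g := map h \o flatten)); last first.
      by move=> x /=; rewrite map_flatten.
    by rewrite map_comp -[LR b](mapK mK) perm_map.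
  - apply/allP => x /mapP[y yX ->]; rewrite pairwise_map.
    apply: sub_in_pairwise (allP h3 _ yX) => // p q py qy.
    have im w : w \in y -> exists w0, w = map g w0.
      move=> wy; have : w \in flatten X by apply/flattenP; exists y.
      by rewrite (perm_mem h1) => /mapP[w0 _ ->]; exists w0.
    have [p0 ->] := im _ py; have [q0 ->] := im _ qy.
    by rewrite /= !mK wle_map.
exists (map (map (map g)) X); rewrite !LR_map; apply/and3P; split.
- by rewrite -map_flatten perm_map.
- rewrite -map_comp (eq_map (g := map g \o flatten)); last first.
    by move=> x /=; rewrite map_flatten.
  by rewrite [map _ X]map_comp perm_map.
- apply/allP => x /mapP[y yX ->]; rewrite pairwise_map.
  apply: sub_pairwise (allP h3 _ yX) => p q /=; by rewrite wle_map.
Qed.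

Lemma coarsenings_map a :
  perm_eq (coarsenings (map g a)) (map (map g) (coarsenings a)).
Proof.
apply: uniq_perm; rewrite ?map_inj_uniq ?coarsenings_uniq //; first exact: inj_map.
move=> b; apply/idP/mapP => [|[c hc ->]]; last first.
  by move: hc; rewrite !mem_coarsenings => /asboolP hc; apply/asboolP/coarser_map.
rewrite mem_coarsenings => /asboolP hb; have [h gK] := mono_can.
have eb : b = map g (map h b).
  rewrite -map_comp -[LHS]map_id; apply/eq_in_map => x.
  by rewrite -(perm_mem (coarser_perm hb)) => /mapP[y _ ->] /=; rewrite gK.
exists (map h b) => //; rewrite mem_coarsenings; apply/asboolP/coarser_map.
by rewrite -eb.
Qed.

End MonoMap.

Lemma park_d_perm v w : perm_eq v w -> park_d v = park_d w.
Proof. by move=> h; apply: eq_ex_minn => i; rewrite (seq.permP h). Qed.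

(** With [d := park_d w], fewer than [d] letters are at most [d], while by minimality at least
    [d - 1] are at most [d - 1]. A letter equal to [d] would contradict this. *)
Lemma park_d_notin w : park_d w \notin w.
Proof.
rewrite /park_d; case: ex_minnP => -[//|d] hd hm; apply/negP => dw.
have : ~~ (count (fun x => x <= d) w < d) by apply/negP => /hm; lia.
have /perm_to_rem/seq.permP E := dw; move: hd; rewrite !E /= leqnn.
have : count (fun x => x <= d) (rem d.+1 w) <= count (fun x => x <= d.+1) (rem d.+1 w).
  by apply: sub_count => x /=; lia.
lia.
Qed.

(* Parkization only closes gaps between the letters, hence it is inverted by an
   increasing map, which is the same for all the rearrangements of a word. *)
Lemma park_mono w : exists g : nat -> nat, {mono g : x y / x <= y} /\
  forall v, perm_eq v w -> v = map g (park v).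
Proof.
have [n] := ubnP (sumn w); elim: n w => // n IH w hn.
case: (eqVneq (park_d w) (size w).+1) => hd.
  exists id; split=> // v vw; rewrite parkE (park_d_perm vw) (perm_size vw) hd eqxx.
  by rewrite map_id.
have [|g [gm gP]] := IH (park_bar w); first by have := sumn_park_bar hd; lia.
(* [g0] reopens the gap at [d] that [park_bar] closes; it is a genuine inverse because [d] is not a
   letter of [w]. *)
pose d := park_d w; pose g0 y := if d <= y then y.+1 else y.
exists (g0 \o g); split=> [x y|v vw].
  rewrite /= -[in RHS]gm /g0; case: (leqP d (g x)); case: (leqP d (g y)) => h1 h2; lia.
rewrite parkE (park_d_perm vw) (perm_size vw) (negbTE hd) map_comp -gP; last first.
  by rewrite /park_bar (park_d_perm vw) perm_map.
rewrite /park_bar -map_comp -[LHS]map_id (park_d_perm vw); apply/eq_in_map => x xv.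
have := park_d_notin w; rewrite -/d /g0 /=; case: (eqVneq x d) => [<-|xd _].
  by rewrite -(perm_mem vw) xv.
move: xd; case: (ltnP d x) => h1; case: leqP => h2 xd; lia.
Qed.

Lemma pfw_Park w : (forall x, x \in w -> 0 < x) -> pfw (Park w) = park w.
Proof. by move=> h; rewrite /Park pfw_to_pf ?park_is_pf. Qed.

(** The coarsenings of [w] are rearrangements of [w], so a single increasing relabelling inverts
    parkization on all of them, and relabelling commutes with coarsening. *)
Lemma Q_Park (K : fieldType) w : (forall x, x \in w -> 0 < x) ->
  Q K (Park w) = (\sum_(v <- coarsenings w) << Park v >>)%R.
Proof.
move=> hw; have [g [gm gP]] := park_mono w; have ew := gP w (perm_refl w).
rewrite Q_coarsenings pfw_Park // [in RHS]ew.
rewrite (perm_big _ (coarsenings_map gm _)) big_map; apply: eq_big_seq => u.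
rewrite mem_coarsenings => /asboolP /coarser_perm hu; congr (<< _ >>)%R.
rewrite /Park; congr to_pf; apply: (inj_map (incn_inj gm)); apply: gP.
by rewrite [X in perm_eq _ X]ew perm_map // perm_sym.
Qed.

(** * Coproduct *)

Lemma uniq_flatten_map (S T : eqType) (t : S -> seq T) (s : seq S) :
  uniq s -> {in s, forall x, uniq (t x)} ->
  (forall x y z, x \in s -> y \in s -> z \in t x -> z \in t y -> x = y) ->
  uniq (flatten (map t s)).
Proof.
elim: s => //= x s IH /andP[xs us] ut inj.
rewrite cat_uniq ut ?mem_head //= IH //; last first.
- by move=> y z w ys zs; apply: inj; rewrite inE ?ys ?zs orbT.
- by move=> y ys; apply: ut; rewrite inE ys orbT.
rewrite andbT; apply/hasPn => z /flatten_mapP[y ys zy]; apply/negP => zx.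
by move: xs; rewrite (inj x y z) ?ys // inE ?eqxx ?ys ?orbT.
Qed.

Lemma big_flatten_map (V : nmodType) (S T : Type) (t : S -> seq T) (s : seq S) F :
  (\sum_(z <- flatten (map t s)) F z = \sum_(x <- s) \sum_(z <- t x) F z :> V)%R.
Proof. by rewrite big_flatten big_map. Qed.

(** By sortedness, [LR c] is a subsequence of [LR b], hence [c] is a subsequence of [b], which
    yields the mask. *)
Lemma LR_subword b c : {subset LR c <= LR b} -> c \in subwords b.
Proof.
move=> h; have E : LR c = filter (mem (LR c)) (LR b).
  apply: sorted_heads_perm; first exact: sorted_LR.
    by apply: (subseq_sorted ltn_trans _ (sorted_LR b)); rewrite map_subseq // filter_subseq.
  apply: uniq_perm; rewrite ?filter_uniq ?lrset_uniq ?lrset_LR // => w.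
  by rewrite mem_filter /= andb_idr //; apply: h.
have : subseq (rev (LR c)) (rev (LR b)) by rewrite subseq_rev E filter_subseq.
move=> /subseqP[m sm em]; rewrite mem_undup.
have : subseq c b.
  rewrite -[c]flatten_LR -[b]flatten_LR em.
  move: sm; clear em; elim: m (rev (LR b)) => [|[] m IH] [|w s] //=.
  - by move=> [/IH h']; rewrite cat_subseq.
  - by move=> [/IH h']; apply: subseq_trans h' (suffix_subseq _ _).
move=> /subseqP[m' sm' ->]; have {}sm' : size m' == size b by apply/eqP.
by apply/mapP; exists (Tuple sm'); rewrite ?mem_enum.
Qed.

(** The two set conditions say that the two decompositions together list each word of [LR b] once;
    being subwords is then automatic. *)
Lemma mem_splits b x : (x \in splits b) = perm_eq (LR x.1 ++ LR x.2) (LR b).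
Proof.
rewrite mem_filter; apply/idP/idP => [/andP[/andP[/eqP h1 /eqP h2] _]|h].
  apply: uniq_perm; rewrite ?LR_uniq //.
    rewrite cat_uniq !LR_uniq andbT /=; apply/hasPn => w w2; apply/negP => w1.
    have : w \in (Fset x.1 `&` Fset x.2)%fset by rewrite in_fsetI !mem_Fset w1.
    by rewrite h1.
  by move=> w; rewrite mem_cat -!mem_Fset -h2 in_fsetU.
have hm := perm_mem h.
apply/andP; split.
  apply/andP; split; apply/eqP/fsetP => w; rewrite ?in_fsetI ?in_fsetU !mem_Fset ?in_fset0.
    have : uniq (LR x.1 ++ LR x.2) by rewrite (perm_uniq h) LR_uniq.
    rewrite cat_uniq => /and3P[_ /hasPn d _].
    by apply/andP => -[w1 /d]; rewrite /= w1.
  by rewrite -mem_cat hm.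
case: x h hm => c d /= h hm; apply/allpairsP; exists (c, d); split=> //; apply: LR_subword => w wx;
  by rewrite -hm mem_cat wx ?orbT.
Qed.

Lemma splits_uniq b : uniq (splits b).
Proof. by rewrite filter_uniq // allpairs_uniq ?undup_uniq // => -[? ?] [? ?] _ _ [-> ->]. Qed.

Lemma map_uniq_inj (S T : eqType) (f : S -> T) (s : seq S) :
  uniq (map f s) -> {in s &, injective f}.
Proof.
elim: s => //= z s IH /andP[fz us] x y; rewrite !inE.
move=> /orP[/eqP->|xs] /orP[/eqP->|ys] // e; last exact: IH.
  by move: fz; rewrite e map_f.
by move: fz; rewrite -e map_f.
Qed.

Lemma lrset_sub (s t : seq word) : subseq s t -> lrset t -> lrset s.
Proof.
move=> st /andP[ht ut]; apply/andP; split; last exact: subseq_uniq (map_subseq _ st) ut.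
by apply/allP => w /(mem_subseq st); apply: (allP ht).
Qed.

(* A word is a concatenation of factors in at most one way, because its factors
   can be read off one by one from their heads. *)
Lemma flatten_inj_lrset s x y : lrset s -> {subset x <= s} -> {subset y <= s} ->
  flatten x = flatten y -> x = y.
Proof.
move=> /andP[hd us].
elim: x y => [|u x IH] [|v y] // hx hy /=.
- move=> /esym/(congr1 size); rewrite size_cat /=.
  by have := allP hd _ (hy v (mem_head _ _)) => /andP[]; case: (v).
- move=> /(congr1 size); rewrite size_cat /=.
  by have := allP hd _ (hx u (mem_head _ _)) => /andP[]; case: (u).
have us_ := hx u (mem_head _ _); have vs := hy v (mem_head _ _).
have u0 := headmin_nonnil (allP hd _ us_); have v0 := headmin_nonnil (allP hd _ vs).
move=> e; have huv : head 0 u = head 0 v.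
  by rewrite -(head_catl (flatten x) u0) e head_catl.
have uv : u = v by apply: (map_uniq_inj us).
rewrite uv; congr cons; apply: IH.
- by move=> w wx; apply: hx; rewrite inE wx orbT.
- by move=> w wy; apply: hy; rewrite inE wy orbT.
- by move: e; rewrite uv => /eqP; rewrite eqseq_cat // => /andP[_ /eqP].
Qed.

Lemma coarsens_cat X1 X2 s1 s2 t1 t2 : coarsens X1 s1 t1 -> coarsens X2 s2 t2 ->
  coarsens (X1 ++ X2) (s1 ++ s2) (t1 ++ t2).
Proof.
move=> /and3P[f1 m1 p1] /and3P[f2 m2 p2]; apply/and3P; split.
- by rewrite flatten_cat perm_cat.
- by rewrite map_cat perm_cat.
- by rewrite all_cat p1.
Qed.

(** A word of [LR c] is a concatenation of words of [LR a] in only one way, so [c] determines which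
    words of [LR a] are used. *)
Lemma coarser_inj a u v c : {subset LR u <= LR a} -> {subset LR v <= LR a} ->
  coarser u c -> coarser v c -> u = v.
Proof.
have sub p q : {subset LR p <= LR a} -> {subset LR q <= LR a} ->
    coarser p c -> coarser q c -> {subset LR p <= LR q}.
  move=> pa qa [X /and3P[X1 X2 _]] [Y /and3P[Y1 Y2 _]] w.
  rewrite -(perm_mem X1) => /flattenP[x xX wx].
  have /mapP[y yY xy] : flatten x \in map flatten Y.
    by rewrite (perm_mem Y2) -(perm_mem X2) map_f.
  rewrite -(perm_mem Y1); apply/flattenP; exists y => //.
  rewrite -(@flatten_inj_lrset (LR a) x y) ?lrset_LR // => w0 vz.
    by apply: pa; rewrite -(perm_mem X1); apply/flattenP; exists x.
  by apply: qa; rewrite -(perm_mem Y1); apply/flattenP; exists y.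
move=> ua va uc vc; apply: LR_perm_inj; apply: uniq_perm; rewrite ?LR_uniq // => w.
by apply/idP/idP; apply: sub.
Qed.

Lemma mem_splits_sub a y : y \in splits a ->
  {subset LR y.1 <= LR a} /\ {subset LR y.2 <= LR a}.
Proof.
rewrite mem_splits => /perm_mem h.
by split=> w; rewrite -h mem_cat => ->; rewrite ?orbT.
Qed.

(** Coarsening then splitting agrees with splitting then coarsening both parts. Neither list has
    repetitions: a pair [(c, d)] determines [b] through the union of decompositions, and determines
    [y] by [coarser_inj]. *)
Lemma perm_splits_coarsenings a :
  perm_eq (flatten [seq splits b | b <- coarsenings a])
    (flatten [seq [seq (c, d) | c <- coarsenings y.1, d <- coarsenings y.2]
             | y <- splits a]).
Proof.
apply: uniq_perm.
- apply: uniq_flatten_map => [|b _|b c x _ _]; rewrite ?coarsenings_uniq ?splits_uniq //.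
  rewrite !mem_splits => hb hc; apply: LR_perm_inj.
  by rewrite -(permPl hb).
- apply: uniq_flatten_map => [|y _|y z x ya za]; rewrite ?splits_uniq //.
    by rewrite allpairs_uniq ?coarsenings_uniq // => -[? ?] [? ?] _ _ [-> ->].
  move=> /allpairsP[[c d] /= [yc yd ->]] /allpairsP[[c' d'] /= [zc zd [ec ed]]].
  move: zc zd yc yd; rewrite -ec -ed !mem_coarsenings.
  move=> /asboolP zc /asboolP zd /asboolP yc /asboolP yd.
  have [y1 y2] := mem_splits_sub ya; have [z1 z2] := mem_splits_sub za.
  by rewrite [y]surjective_pairing [z]surjective_pairing
    (coarser_inj y1 z1 yc zc) (coarser_inj y2 z2 yd zd).
move=> [c d]; apply/flatten_mapP/flatten_mapP => -[].
  move=> b; rewrite mem_coarsenings mem_splits /= => /asboolP[X hX] hb.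
  have /and3P[h1 h2 h3] := hX.
  (* A group goes to the side of [c] or of [d] according to where its concatenation lies. *)
  pose p (x : seq word) := flatten x \in LR c.
  have [u1 u2 u3] : [/\ uniq (LR c), uniq (LR d) & forall w, w \in LR d -> w \notin LR c].
    by rewrite !LR_uniq; split=> // w wd; have := LR_uniq b; rewrite -(perm_uniq hb)
      cat_uniq => /and3P[_ /hasPn /(_ w wd)].
  have pX : perm_eq (filter p X ++ filter (predC p) X) X by rewrite perm_filterC.
  have m12 : perm_eq (map flatten X) (LR c ++ LR d) by rewrite (permPl h2) perm_sym.
  have m1 : perm_eq (map flatten (filter p X)) (LR c).
    rewrite -(filter_map _ (mem (LR c))) (permPl (perm_filter _ m12)) filter_cat.
    rewrite (all_filterP _); last exact/allP.
    rewrite (_ : filter _ (LR d) = [::]) ?cats0 //.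
    by apply/eqP; rewrite -(negbK (_ == _)) -has_filter; apply/hasPn => w /u3.
  have m2 : perm_eq (map flatten (filter (predC p) X)) (LR d).
    rewrite -(perm_cat2l (LR c)) -(permPr m12) -(permPr (perm_map _ pX)) map_cat.
    by rewrite perm_cat2r perm_sym.
  have ff : perm_eq (flatten (filter p X) ++ flatten (filter (predC p) X)) (LR a).
    by rewrite -flatten_cat -(permPr h1) perm_flatten.
  have ok : lrset (flatten (filter p X) ++ flatten (filter (predC p) X)).
    by rewrite (lrset_perm ff) lrset_LR.
  have ok1 := lrset_sub (prefix_subseq _ _) ok.
  have ok2 := lrset_sub (suffix_subseq _ _) ok.
  exists (lrcat (flatten (filter p X)), lrcat (flatten (filter (predC p) X))).
    rewrite mem_splits /= -(permPr ff); apply: perm_cat; exact: LR_lrcat.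
  apply/allpairsP; exists (c, d); rewrite /= !mem_coarsenings; split=> //; apply/asboolP.
    exists (filter p X); apply/and3P; split=> //; first by rewrite perm_sym LR_lrcat.
    by apply/allP => x; rewrite mem_filter => /andP[_]; apply: (allP h3).
  exists (filter (predC p) X); apply/and3P; split=> //; first by rewrite perm_sym LR_lrcat.
  by apply/allP => x; rewrite mem_filter => /andP[_]; apply: (allP h3).
(* Conversely, groupings of the two parts are put side by side to form a grouping of [LR a]. *)
move=> y ya /allpairsP[[c' d'] /= [yc yd [-> ->]]] {c d}.
move: yc yd; rewrite !mem_coarsenings => /asboolP[X1 hX1] /asboolP[X2 hX2].
rewrite mem_splits in ya.
have hX := coarsens_cat hX1 hX2.
rewrite (coarsens_perm (perm_refl _) ya (perm_refl _)) in hX.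
have t0 : [::] \notin LR c' ++ LR d' by rewrite mem_cat negb_or !LR_nonnil.
have [ok ht] := coarser_lrset hX t0.
exists (lrcat (LR c' ++ LR d')); first by rewrite mem_coarsenings; apply/asboolP.
by rewrite mem_splits /= perm_sym LR_lrcat.
Qed.

Lemma Delta_Q (K : fieldType) (a : pf) : (Delta (Q K a) =
  \sum_(x <- splits a) tensor (Q K (Park x.1)) (Q K (Park x.2)))%R.
Proof.
have TM (u v : pf) : tensor (M K u) (M K v) = << (u, v) >>%R.
  by rewrite /tensor /M !linextU.
rewrite Q_coarsenings /Delta linear_sum.
transitivity (\sum_(x <- flatten [seq splits b | b <- coarsenings a])
                << (Park x.1, Park x.2) >> : PFSym2 K)%R.
  rewrite big_flatten_map; apply: eq_big_seq => b hb.
  rewrite /= linextU /DeltaM pfw_to_pf ?(pf_coarsening hb) //.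
  by apply: eq_bigr => x _; rewrite TM.
rewrite (perm_big _ (perm_splits_coarsenings a)) big_flatten_map.
apply: eq_big_seq => y ya; have [y1 y2] := mem_splits_sub ya.
have pos w : {subset LR w <= LR a} -> forall x, x \in w -> 0 < x.
  move=> h x; rewrite -(perm_mem (perm_flatten_LR w)) => /flattenP[v /h va xv].
  have : x \in pfw a by rewrite -(perm_mem (perm_flatten_LR a)); apply/flattenP; exists v.
  by have /is_pfP[p _] := pfP a; apply: p.
rewrite !Q_Park; try exact: pos.
by rewrite big_allpairs /tensor linext2_sum.
Qed.

(** * Product *)

Definition nonnil (w : word) : bool := w != [::].

Lemma filter_all_nil (T : Type) (q : pred T) w : all (predC q) w -> filter q w = [::].
Proof.
by elim: w => //= x w IH /andP[/negbTE -> /IH].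
Qed.

(** * Matchings recovered from two kinds of letters *)

Section MatchJoin.
Variable p : pred nat.
Notation lo := (filter p).
Notation hi := (filter (predC p)).

Section Decode.
Variables (A B : {fset word}) (T : {fset word * word}).
Hypothesis hA : forall u, u \in A -> nonnil u && all p u.
Hypothesis hB : forall v, v \in B -> nonnil v && all (predC p) v.
Hypothesis hT : T \in matchings A B.

Let TE e : e \in T -> e.1 \in A /\ e.2 \in B.
Proof.
by move: hT; rewrite mem_matchings => /andP[/fsubsetP sT _] /sT; rewrite in_fsetM => /andP.
Qed.

Let TI e f : e \in T -> f \in T -> e.1 = f.1 \/ e.2 = f.2 -> e = f.
Proof. by move: hT; rewrite mem_matchings => /andP[_ /is_matchingP]; apply. Qed.

Let loA u : u \in A -> lo u = u.
Proof. by move=> /hA /andP[_ /all_filterP]. Qed.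
Let hiA u : u \in A -> hi u = [::].
Proof.
by move=> /hA /andP[_ h]; apply: filter_all_nil; apply: sub_all h => x /=; rewrite negbK.
Qed.
Let loB u : u \in B -> lo u = [::].
Proof. by move=> /hB /andP[_ h]; apply: filter_all_nil. Qed.
Let hiB u : u \in B -> hi u = u.
Proof. by move=> /hB /andP[_ /all_filterP]. Qed.
Let loT e : e \in T -> lo (e.1 ++ e.2) = e.1.
Proof. by move=> /TE[h1 h2]; rewrite filter_cat loA // loB // cats0. Qed.
Let hiT e : e \in T -> hi (e.1 ++ e.2) = e.2.
Proof. by move=> /TE[h1 h2]; rewrite filter_cat hiA // hiB. Qed.

Let joinP w : reflect
  [\/ w \in A /\ (forall e, e \in T -> e.1 != w),
      w \in B /\ (forall e, e \in T -> e.2 != w)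
    | exists2 e, e \in T & w = e.1 ++ e.2] (w \in joinF A B T).
Proof.
rewrite /joinF in_fsetU in_fsetD !in_fsetU negb_or.
apply: (iffP orP) => [[/andP[/andP[n1 n2] /orP[]] h|/imfsetP[e /= eT ->]]|[] [h]].
- constructor 1; split=> // e eT; apply: contra n1 => /eqP <-.
  by apply/imfsetP; exists e.
- constructor 2; split=> // e eT; apply: contra n2 => /eqP <-.
  by apply/imfsetP; exists e.
- by constructor 3; exists e.
- move=> n; left; rewrite h andbT; apply/andP; split; apply/negP => /imfsetP[e /= eT E].
    by move: (n e eT); rewrite E eqxx.
  have [_ /loB] := TE eT; rewrite -E loA // => w0.
  by have := hA h; rewrite w0.
- move=> n; left; rewrite h orbT andbT; apply/andP; split; apply/negP => /imfsetP[e /= eT E].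
    have [/hiA] := TE eT; rewrite -E hiB // => w0.
    by have := hB h; rewrite w0.
  by move: (n e eT); rewrite E eqxx.
- by move=> hT' ->; right; apply/imfsetP; exists h.
Qed.

Lemma joinF_lohi w : w \in joinF A B T -> w = lo w ++ hi w.
Proof.
case/joinP => [[h _]|[h _]|[e eT ->]].
- by rewrite loA // hiA // cats0.
- by rewrite loB // hiB.
- by rewrite loT // hiT.
Qed.

Lemma joinF_nonnil w : w \in joinF A B T -> nonnil w.
Proof.
case/joinP => [[/hA/andP[]] //|[/hB/andP[]] //|[e /TE[/hA/andP[h _] _] ->]].
by move: h; case: (e.1).
Qed.

(** The [p]-part of a joined word is an unmatched word of [A], the left end of an edge, or empty.
    The matching condition keeps the nonempty ones distinct. *)
Lemma perm_lo_joinF : perm_eq A [seq u <- map lo (joinF A B T) | nonnil u].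
Proof.
apply: uniq_perm; first exact: fset_uniq.
  rewrite filter_map map_inj_in_uniq ?filter_uniq ?fset_uniq // => w w'.
  rewrite !mem_filter => /andP[/= n /joinP h] /andP[/= n' /joinP h'] E.
  case: h n E => [[wA wn]|[/loB -> //]|[e eT ->]] n.
    rewrite (loA wA); case: h' n' => [[wA' _]|[/loB -> //]|[f fT ->]] n'; first by rewrite loA.
    by rewrite loT // => E; have := wn f fT; rewrite E eqxx.
  rewrite loT //; case: h' n' => [[wA' wn]|[/loB -> //]|[f fT ->]] n'.
    by rewrite loA // => E; have := wn e eT; rewrite E eqxx.
  by rewrite loT // => E; rewrite (TI eT fT (or_introl E)).
move=> u; rewrite mem_filter; apply/idP/andP => [uA|[n /mapP[w /joinP h E]]].
  have /andP[n _] := hA uA; split=> //; apply/mapP.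
  case: (boolP [exists e : T, (val e).1 == u]) => [/existsP[e /eqP eu]|/existsPn h].
    exists ((val e).1 ++ (val e).2); last by rewrite loT ?eu // fsvalP.
    by apply/joinP; constructor 3; exists (val e); rewrite ?fsvalP.
  exists u; last by rewrite loA.
  by apply/joinP; constructor 1; split=> // e eT; apply: (h [` eT]%fset).
case: h E n => [[wA _] -> _|[/loB -> _] -> //|[e eT ->] -> _]; first by rewrite loA.
by rewrite loT //; case: (TE eT).
Qed.

Lemma perm_hi_joinF : perm_eq B [seq u <- map hi (joinF A B T) | nonnil u].
Proof.
apply: uniq_perm; first exact: fset_uniq.
  rewrite filter_map map_inj_in_uniq ?filter_uniq ?fset_uniq // => w w'.
  rewrite !mem_filter => /andP[/= n /joinP h] /andP[/= n' /joinP h'] E.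
  case: h n E => [[/hiA -> //]|[wB wn]|[e eT ->]] n.
    rewrite (hiB wB); case: h' n' => [[/hiA -> //]|[wB' _]|[f fT ->]] n'; first by rewrite hiB.
    by rewrite hiT // => E; have := wn f fT; rewrite E eqxx.
  rewrite hiT //; case: h' n' => [[/hiA -> //]|[wB' wn]|[f fT ->]] n'.
    by rewrite hiB // => E; have := wn e eT; rewrite E eqxx.
  by rewrite hiT // => E; rewrite (TI eT fT (or_intror E)).
move=> u; rewrite mem_filter; apply/idP/andP => [uB|[n /mapP[w /joinP h E]]].
  have /andP[n _] := hB uB; split=> //; apply/mapP.
  case: (boolP [exists e : T, (val e).2 == u]) => [/existsP[e /eqP eu]|/existsPn h].
    exists ((val e).1 ++ (val e).2); last by rewrite hiT ?eu // fsvalP.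
    by apply/joinP; constructor 3; exists (val e); rewrite ?fsvalP.
  exists u; last by rewrite hiB.
  by apply/joinP; constructor 2; split=> // e eT; apply: (h [` eT]%fset).
case: h E n => [[/hiA -> _] -> //|[wB _] -> _|[e eT ->] -> _]; first by rewrite hiB.
by rewrite hiT //; case: (TE eT).
Qed.

(** Edges correspond to the joined words that contain letters of both kinds. *)
Lemma mem_match_joinF e : (e \in T) =
  [&& nonnil e.1, nonnil e.2 & has (fun w => (lo w, hi w) == e) (joinF A B T)].
Proof.
apply/idP/and3P => [eT|[n1 n2 /hasP[w /joinP h /eqP E]]].
  have [/hA/andP[n1 _] /hB/andP[n2 _]] := TE eT; split=> //; apply/hasP.
  exists (e.1 ++ e.2); last by rewrite loT // hiT // -surjective_pairing.
  by apply/joinP; constructor 3; exists e.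
move: n1 n2; rewrite -E /=.
case: h {E} => [[/hiA -> //]|[/loB -> //]|[f fT ->]] _ _.
by rewrite loT // hiT // -surjective_pairing.
Qed.

End Decode.

Lemma joinF_inj A B T A' B' T' :
  (forall u, u \in A -> nonnil u && all p u) ->
  (forall v, v \in B -> nonnil v && all (predC p) v) ->
  (forall u, u \in A' -> nonnil u && all p u) ->
  (forall v, v \in B' -> nonnil v && all (predC p) v) ->
  T \in matchings A B -> T' \in matchings A' B' ->
  joinF A B T = joinF A' B' T' -> [/\ A = A', B = B' & T = T'].
Proof.
move=> hA hB hA' hB' hT hT' E; split; apply/fsetP => x.
- by rewrite (perm_mem (perm_lo_joinF hA hB hT)) (perm_mem (perm_lo_joinF hA' hB' hT')) E.
- by rewrite (perm_mem (perm_hi_joinF hA hB hT)) (perm_mem (perm_hi_joinF hA' hB' hT')) E.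
- by rewrite (mem_match_joinF hA hB hT) (mem_match_joinF hA' hB' hT') E.
Qed.

(** The edges are the pairs [(lo w, hi w)] with both parts nonempty. They form a matching because
    [A] and [B], being sets, have no repetitions, so a nonempty part determines its word. *)
Lemma joinF_surj (W A B : {fset word}) :
  (forall w, w \in W -> nonnil w /\ w = lo w ++ hi w) ->
  perm_eq A [seq u <- map lo W | nonnil u] ->
  perm_eq B [seq u <- map hi W | nonnil u] ->
  exists2 T, T \in matchings A B & W = joinF A B T.
Proof.
move=> hW pA pB.
have injlo w w' : w \in W -> w' \in W -> nonnil (lo w) -> lo w = lo w' -> w = w'.
  move=> wW wW' n E; have : uniq [seq u <- map lo W | nonnil u].
    by rewrite -(perm_uniq pA) fset_uniq.
  rewrite filter_map => /map_uniq_inj; apply=> //; rewrite mem_filter /= ?wW ?wW' andbT //.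
  by rewrite -E.
have injhi w w' : w \in W -> w' \in W -> nonnil (hi w) -> hi w = hi w' -> w = w'.
  move=> wW wW' n E; have : uniq [seq u <- map hi W | nonnil u].
    by rewrite -(perm_uniq pB) fset_uniq.
  rewrite filter_map => /map_uniq_inj; apply=> //; rewrite mem_filter /= ?wW ?wW' andbT //.
  by rewrite -E.
have mA u : (u \in A) = nonnil u && (u \in map lo W) by rewrite (perm_mem pA) mem_filter.
have mB u : (u \in B) = nonnil u && (u \in map hi W) by rewrite (perm_mem pB) mem_filter.
pose T := [fset e in [seq (lo w, hi w) | w <- W & nonnil (lo w) && nonnil (hi w)]]%fset.
have TP e : reflect (exists w, [/\ w \in W, nonnil (lo w), nonnil (hi w) & e = (lo w, hi w)])
                    (e \in T).
  rewrite in_fset; apply: (iffP mapP) => [[w]|[w [wW n1 n2 ->]]].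
    by rewrite mem_filter => /andP[/andP[n1 n2] wW] ->; exists w.
  by exists w; rewrite ?mem_filter ?n1 ?n2.
exists T.
  rewrite mem_matchings; apply/andP; split.
    apply/fsubsetP => e /TP[w [wW n1 n2 ->]].
    by rewrite in_fsetM mA mB /= n1 n2 !map_f.
  apply/is_matchingP => e f /TP[w [wW n1 n2 ->]] /TP[w' [wW' n1' n2' ->]] /= [] E.
    by rewrite (injlo w w').
  by rewrite (injhi w w').
apply/fsetP => w; rewrite /joinF in_fsetU in_fsetD !in_fsetU negb_or mA mB.
apply/idP/idP => [wW|/orP[/andP[/andP[n1 n2]]|/imfsetP[e /TP[v [vW n1 n2 ->]] ->]]].
- have [nw ew] := hW w wW; rewrite nw /=.
  case: (boolP (nonnil (lo w))) => n1; last first.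
    have w0 : lo w = [::] by apply/eqP; rewrite -[_ == _]negbK.
    have eh : hi w = w by rewrite {2}ew w0.
    have -> : w \in map hi W by rewrite -{1}eh map_f.
    rewrite orbT andbT; apply/orP; left; apply/andP.
    split; apply/negP => /imfsetP[e /TP[v [vW m1 m2 ->]] E].
      have E' : w = lo v := E.
      (* Filtering is idempotent, so [w = lo v] with [lo w] empty would make [lo v] empty. *)
      by move: m1; rewrite -filter_id -E' w0.
    by move: m1; rewrite /nonnil -(injhi w v) ?w0 // eh.
  case: (boolP (nonnil (hi w))) => n2.
    apply/orP; right; apply/imfsetP; exists (lo w, hi w) => //=.
    by apply/TP; exists w.
  have w0 : hi w = [::] by apply/eqP; rewrite -[_ == _]negbK.
  have eh : lo w = w by rewrite {2}ew w0 cats0.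
  have -> : w \in map lo W by rewrite -{1}eh map_f.
  rewrite andbT; apply/orP; left; apply/andP.
  split; apply/negP => /imfsetP[e /TP[v [vW m1 m2 ->]] E].
    by move: m2; rewrite /nonnil -(injlo w v) ?w0 // eh.
  have E' : w = hi v := E.
  by move: m2; rewrite -filter_id -E' w0.
- rewrite -andb_orr => /andP[nw /orP[] /mapP[v vW E]].
    have [_ ev] := hW v vW.
    case: (boolP (nonnil (hi v))) => n; last first.
      have v0 : hi v = [::] by apply/eqP; rewrite -[_ == _]negbK.
      by rewrite E -[X in X \in W](cats0 (lo v)) -v0 -ev.
    case/negP: n1; apply/imfsetP; exists (lo v, hi v) => //=.
    by apply/TP; exists v; rewrite -E.
  have [_ ev] := hW v vW.
  case: (boolP (nonnil (lo v))) => n; last first.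
    have v0 : lo v = [::] by apply/eqP; rewrite -[_ == _]negbK.
    by rewrite E -[X in X \in W](cat0s (hi v)) -v0 -ev.
  case/negP: n2; apply/imfsetP; exists (lo v, hi v) => //=.
  by apply/TP; exists v; rewrite -E.
- by rewrite /=; have [_ <-] := hW v vW.
Qed.

End MatchJoin.

(** All heads of [LR u] lie below those of [LR v], so the concatenated list is already sorted. *)
Lemma LR_sep (u v : word) : (forall x y, x \in u -> y \in v -> x < y) ->
  LR (v ++ u) = LR u ++ LR v.
Proof.
move=> h; rewrite -{1}(flatten_LR u) -{1}(flatten_LR v) -flatten_cat -rev_cat.
have hu := headmin_LR u; have hv := headmin_LR v.
rewrite LR_flatten_rev ?all_cat ?hu //.
have := sorted_LR u; have := sorted_LR v; rewrite !(sorted_pairwise ltn_trans) => sv su.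
rewrite map_cat pairwise_cat su sv !andbT; apply/allrelP => x y.
move=> /mapP[u' u'u ->] /mapP[v' v'v ->]; apply: h.
  rewrite -(perm_mem (perm_flatten_LR u)); apply/flattenP; exists u' => //.
  exact/mem_head_nonnil/headmin_nonnil/(allP hu).
rewrite -(perm_mem (perm_flatten_LR v)); apply/flattenP; exists v' => //.
exact/mem_head_nonnil/headmin_nonnil/(allP hv).
Qed.

(** * Chains cut at a threshold letter *)

Section Chain.
Variable p : pred nat.
Hypothesis p_down : forall x y, x <= y -> p y -> p x.
Variable x : seq word.
Hypothesis hx : forall u, u \in x -> nonnil u && (all p u || all (predC p) u).

Lemma filter_flatten_lo : filter p (flatten x) = flatten (filter (all p) x).
Proof.
elim: x hx => //= u y IH hy; rewrite filter_cat IH; last first.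
  by move=> v vy; apply: hy; rewrite inE vy orbT.
have /andP[n] := hy u (mem_head _ _).
case: (boolP (all p u)) => [/all_filterP -> //|_ /= h].
by rewrite filter_all_nil.
Qed.

Lemma filter_flatten_hi : filter (predC p) (flatten x) = flatten (filter (predC (all p)) x).
Proof.
elim: x hx => //= u y IH hy; rewrite filter_cat IH; last first.
  by move=> v vy; apply: hy; rewrite inE vy orbT.
have /andP[n] := hy u (mem_head _ _).
case: (boolP (all p u)) => [h _|_ /= /all_filterP -> //].
by rewrite filter_all_nil //; apply: sub_all h => z /=; rewrite negbK.
Qed.

Lemma chain_split : pairwise wle x ->
  x = filter (all p) x ++ filter (predC (all p)) x.
Proof.
elim: x hx => //= u y IH hy /andP[hu py].
have hy' v : v \in y -> nonnil v && (all p v || all (predC p) v).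
  by move=> vy; apply: hy; rewrite inE vy orbT.
have {}IH := IH hy' py.
case: (boolP (all p u)) => [pu|npu] /=; first by rewrite -IH.
have /andP[n] := hy u (mem_head _ _); rewrite (negbTE npu) /= => nu.
have npy v : v \in y -> ~~ all p v.
  move=> vy; apply/negP => pv; have /andP[nv _] := hy' v vy.
  have /wleP h := allP hu v vy; have := allP nu _ (mem_head_nonnil n).
  rewrite /= (p_down (h _ _ (mem_head_nonnil n) (mem_head_nonnil nv))) //.
  by apply: (allP pv); apply: mem_head_nonnil.
rewrite (filter_all_nil (q := all p)); last exact/allP.
by congr cons; symmetry; apply/all_filterP/allP.
Qed.

End Chain.

Lemma flatten_filter_nonnil (s : seq (seq word)) :
  flatten [seq x <- s | x != [::]] = flatten s.
Proof. by elim: s => //= -[|u x] s IH //=; rewrite IH. Qed.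

Lemma flatten_nonnil (x : seq word) : all nonnil x -> nonnil (flatten x) = (x != [::]).
Proof. by case: x => [|[|z u] x]. Qed.

(** * Coarsenings of a slash product *)

Section Slash.
Variables (a b : word) (m : nat).
Hypothesis ha : forall x, x \in a -> x <= m.
Hypothesis hb : forall x, x \in b -> m < x.

Notation p := (fun x => x <= m).

Let LRba : LR (b ++ a) = LR a ++ LR b.
Proof. by apply: LR_sep => x y /ha h1 /hb h2; apply: leq_ltn_trans h2. Qed.

Lemma lowF a' : perm_eq a a' -> forall u, u \in Fset a' -> nonnil u && all p u.
Proof.
move=> pa u uF; apply/andP; split.
  by apply: contraTneq uF => ->; rewrite mem_Fset LR_nonnil.
by apply/allP => x xu; apply: ha; rewrite (perm_mem pa) (mem_Fset_sub uF).
Qed.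

Lemma highF b' : perm_eq b b' -> forall u, u \in Fset b' -> nonnil u && all (predC p) u.
Proof.
move=> pb u uF; apply/andP; split.
  by apply: contraTneq uF => ->; rewrite mem_Fset LR_nonnil.
apply/allP => x xu /=; rewrite -ltnNge; apply: hb.
by rewrite (perm_mem pb) (mem_Fset_sub uF).
Qed.

Lemma Fset_perm c : perm_eq (Fset c) (LR c).
Proof. by apply: uniq_perm; rewrite ?fset_uniq ?LR_uniq // => w; rewrite mem_Fset. Qed.

(** Each group is cut into its words from [LR a] followed by its words from [LR b]. The two families
    of halves are groupings of [LR a] and [LR b], and [joinF_surj] supplies the matching. *)
Lemma coarser_slash_decode c : coarser (b ++ a) c ->
  exists a' b' T, [/\ coarser a a', coarser b b',
    T \in matchings (Fset a') (Fset b') & Fset c = joinF (Fset a') (Fset b') T].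
Proof.
move=> [X /and3P[h1 h2 h3]]; rewrite LRba in h1.
have hX x u : x \in X -> u \in x -> u \in LR a \/ u \in LR b.
  move=> xX ux; apply/orP; rewrite -mem_cat -(perm_mem h1).
  by apply/flattenP; exists x.
have La u : u \in LR a -> nonnil u && all p u by rewrite -mem_Fset; apply: lowF.
have Lb u : u \in LR b -> nonnil u && all (predC p) u by rewrite -mem_Fset; apply: highF.
have Lb' u : u \in LR b -> ~~ all p u.
  move=> /Lb /andP[n h]; apply/allPn; exists (head 0 u); first exact: mem_head_nonnil.
  by apply: (allP h); apply: mem_head_nonnil.
have hom x : x \in X -> forall u, u \in x -> nonnil u && (all p u || all (predC p) u).
  by move=> xX u /(hX _ _ xX)[/La/andP[-> ->]|/Lb/andP[-> ->]]; rewrite ?orbT.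
have nn x : x \in X -> all nonnil x.
  by move=> xX; apply/allP => u /(hom x xX) /andP[].
have pd x y : x <= y -> p y -> p x by move=> xy; apply: leq_trans.
(* Empty halves are dropped, so that every group has a nonempty concatenation. *)
pose Xa := [seq x <- map (filter (all p)) X | x != [::]].
pose Xb := [seq x <- map (filter (predC (all p))) X | x != [::]].
have fa : perm_eq (flatten Xa) (LR a).
  rewrite flatten_filter_nonnil -filter_flatten (permPl (perm_filter _ h1)) filter_cat.
  rewrite (all_filterP _); last by apply/allP => u /La /andP[].
  by rewrite filter_all_nil ?cats0 //; apply/allP => u /Lb'.
have fb : perm_eq (flatten Xb) (LR b).
  rewrite flatten_filter_nonnil -filter_flatten (permPl (perm_filter _ h1)) filter_cat.
  rewrite filter_all_nil; last by apply/allP => u /La /andP[_] /=; rewrite negbK.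
  by rewrite /= (all_filterP _) //; apply/allP => u /Lb'.
have pwa : all (pairwise wle) Xa.
  apply/allP => x; rewrite mem_filter => /andP[_ /mapP[y yX ->]].
  by rewrite (subseq_pairwise (filter_subseq _ _)) // (allP h3).
have pwb : all (pairwise wle) Xb.
  apply/allP => x; rewrite mem_filter => /andP[_ /mapP[y yX ->]].
  by rewrite (subseq_pairwise (filter_subseq _ _)) // (allP h3).
have n0 q : all nonnil (map flatten [seq x <- map (filter q) X | x != [::]]).
  apply/allP => w /mapP[x]; rewrite mem_filter => /andP[n /mapP[y yX ey]] ->.
  rewrite flatten_nonnil // ey; apply/allP => u.
  by rewrite mem_filter => /andP[_]; apply: (allP (nn y yX)).
have n0' q : [::] \notin map flatten [seq x <- map (filter q) X | x != [::]].
  by apply/negP => /(allP (n0 q)).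
have ca : coarsens Xa (LR a) (map flatten Xa) by apply/and3P.
have cb : coarsens Xb (LR b) (map flatten Xb) by apply/and3P.
have [oka Ca] := coarser_lrset ca (n0' _); have [okb Cb] := coarser_lrset cb (n0' _).
exists (lrcat (map flatten Xa)), (lrcat (map flatten Xb)).
(* Selecting words inside the groups amounts to selecting letters inside the words of [c]. *)
have gen q r : (forall x, x \in X -> filter r (flatten x) = flatten (filter q x)) ->
    perm_eq (map flatten [seq x <- map (filter q) X | x != [::]])
            [seq u <- map (filter r) (Fset c) | nonnil u].
  move=> E; rewrite -(permPr (perm_filter _ (perm_map _ (perm_trans h2 _)))); last first.
    by rewrite perm_sym Fset_perm.
  rewrite -map_comp.
  have -> : map (filter r \o flatten) X = map flatten (map (filter q) X).
    by rewrite -map_comp; apply/eq_in_map.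
  rewrite [X in perm_eq _ X]filter_map.
  rewrite (eq_in_filter (a2 := fun x => x != [::])) // => x /mapP[y yX ->] /=.
  rewrite flatten_nonnil //; apply/allP => u.
  by rewrite mem_filter => /andP[_]; apply: (allP (nn y yX)).
have [|||T hT E] := @joinF_surj p (Fset c) (Fset (lrcat (map flatten Xa)))
  (Fset (lrcat (map flatten Xb))).
- move=> w; rewrite mem_Fset -(perm_mem h2) => /mapP[x xX ->].
  rewrite (filter_flatten_lo (hom x xX)) (filter_flatten_hi (hom x xX)) -flatten_cat.
  rewrite -(chain_split pd (hom x xX)) ?(allP h3) //; split=> //.
  rewrite flatten_nonnil ?nn //; apply: contraTneq xX => ->; apply/negP => /(map_f flatten).
  by rewrite (perm_mem h2); apply/negP; apply: LR_nonnil.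
- rewrite (permPl (Fset_perm _)) (permPl (LR_lrcat oka)); apply: gen => x xX.
  exact: filter_flatten_lo (hom x xX).
- rewrite (permPl (Fset_perm _)) (permPl (LR_lrcat okb)); apply: gen => x xX.
  exact: filter_flatten_hi (hom x xX).
by exists T.
Qed.

(* The pieces of a matching form chains of length one or two. *)
Lemma coarser_join T : T \in matchings (Fset a) (Fset b) ->
  perm_eq (LR (wcat (joinF (Fset a) (Fset b) T))) (joinF (Fset a) (Fset b) T) /\
  coarser (b ++ a) (wcat (joinF (Fset a) (Fset b) T)).
Proof.
move=> hT; set W := joinF _ _ T.
have hA := lowF (perm_refl a); have hB := highF (perm_refl b).
have n0 : [::] \notin W by apply/negP => /(joinF_nonnil hA hB hT).
pose X := [seq [seq u <- [:: filter p w; filter (predC p) w] | nonnil u] | w <- W].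
have cX : coarsens X (LR (b ++ a)) W.
  apply/and3P; split.
  - rewrite LRba -(permPr (perm_cat (Fset_perm a) (Fset_perm b))).
    rewrite (permPr (perm_cat (perm_lo_joinF hA hB hT) (perm_hi_joinF hA hB hT))) -/W /X.
    apply/seq.permP => q; rewrite count_cat; elim: (enum_fset W) => //= w s IH.
    rewrite !count_cat IH; case: (nonnil (filter p w)); case: (nonnil (filter _ w)) => /=; lia.
  - rewrite /X -map_comp -[X in perm_eq _ X]map_id.
    set f := flatten \o _; suff /eq_in_map -> : {in W, f =1 id} by [].
    move=> w wW; rewrite {2}(joinF_lohi hA hB hT wW) /f /= /nonnil.
    case: eqP => [->|_] /=; case: eqP => [->|_] //=; by rewrite ?cats0.
  - apply/allP => x /mapP[w wW ->] /=.
    case: nonnil; case: nonnil => //=; rewrite !andbT.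
    apply/wleP => y z; rewrite !mem_filter /= => /andP[h1 _] /andP[h2 _]; lia.
have [ok Cj] := coarser_lrset cX n0.
by split; first exact: LR_lrcat.
Qed.

End Slash.

Lemma shiftw_mono m : {mono addn^~ m : x y / x <= y}.
Proof. by move=> x y; rewrite leq_add2r. Qed.

Lemma shiftw_inj m : injective (shiftw^~ m).
Proof. exact/inj_map/addIn. Qed.

Lemma Fset_shiftw w m : Fshift w m = Fset (shiftw w m).
Proof.
apply/fsetP => v; rewrite mem_Fset (LR_map (@shiftw_mono m)).
apply/imfsetP/mapP => [[u /= uw ->]|[u uw ->]]; exists u => //.
  by rewrite -mem_Fset.
by rewrite /= mem_Fset.
Qed.

Lemma wcat_lrcat (S : {fset word}) : wcat S = lrcat S.
Proof. by []. Qed.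

Lemma Fset_inj : injective Fset.
Proof.
by move=> a b E; apply: LR_perm_inj; rewrite -(permPl (Fset_perm a)) E Fset_perm.
Qed.

Lemma wcat_Fset w : wcat (Fset w) = w.
Proof.
rewrite wcat_lrcat -[RHS]lrcat_LR; apply: lrcat_perm; last exact: Fset_perm.
by rewrite (lrset_perm (Fset_perm w)) lrset_LR.
Qed.

Lemma Fset_wcat (S : {fset word}) : perm_eq (LR (wcat S)) S -> Fset (wcat S) = S.
Proof. by move=> h; apply/fsetP => w; rewrite mem_Fset (perm_mem h). Qed.

Lemma matchings_uniq A B : uniq (matchings A B).
Proof. by rewrite filter_uniq // fset_uniq. Qed.

Lemma matchings_fset0 A B : A = fset0 \/ B = fset0 -> perm_eq (matchings A B) [:: fset0].
Proof.
move=> h; apply: uniq_perm; rewrite ?matchings_uniq // => T.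
have -> : (T \in matchings A B) = (T `<=` fset0)%fset && is_matching T.
  rewrite mem_matchings; congr (_ && _); congr (_ `<=` _)%fset.
  by apply/fsetP => e; rewrite in_fsetM in_fset0; case: h => ->; rewrite in_fset0 ?andbF.
rewrite inE fsubset0; case: eqP => [->|//].
by apply/is_matchingP => e f; rewrite in_fset0.
Qed.

Lemma joinF_fset0 A B : joinF A B fset0 = (A `|` B)%fset.
Proof.
apply/fsetP => w; rewrite /joinF in_fsetU in_fsetD !in_fsetU.
have E (f : word * word -> word) :
    (w \in [fset f e | e in (fset0 : {fset word * word})]%fset) = false.
  by apply/imfsetP => -[e /=]; rewrite in_fset0.
by rewrite !E /= orbF.
Qed.

(** The unit cases follow the general formula: when one side is empty, the only matching is the
    empty one. *)
Lemma starM_matchings (K : fieldType) (a b : pf) : (starM K a b =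
  \sum_(T <- matchings (Fset a) (Fshift b (size a))) M K (to_pf (join a b T)))%R.
Proof.
have F0 : Fset [::] = fset0 by apply/fsetP => w; rewrite mem_Fset in_fset0.
rewrite /starM; case: eqP => [->|_].
  rewrite (perm_big _ (matchings_fset0 _)) /=; last by left.
  rewrite big_seq1 /join joinF_fset0 Fset_shiftw F0 fset0U wcat_Fset.
  rewrite /shiftw (eq_map (g := id)) ?map_id; last by move=> x; rewrite /= addn0.
  by congr M; apply: val_inj; rewrite /= pfw_to_pf ?pfP.
case: eqP => [->|//].
rewrite (perm_big _ (matchings_fset0 _)) /=; last by right; rewrite Fset_shiftw F0.
rewrite big_seq1 /join joinF_fset0 Fset_shiftw F0 fsetU0 wcat_Fset.
by congr M; apply: val_inj; rewrite /= pfw_to_pf ?pfP.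
Qed.

Section Product.
Variables (a b : pf).
Notation m := (size a).

Let low a' : coarser a a' -> forall x, x \in a' -> x <= m.
Proof.
move=> /coarser_perm h x; rewrite -(perm_mem h) => xa.
by have /andP[/allP /(_ x xa) /andP[]] := pfP a.
Qed.

Let high b' : coarser b b' -> forall x, x \in shiftw b' m -> m < x.
Proof.
move=> /coarser_perm h x /mapP[y]; rewrite -(perm_mem h) => yb ->.
by have /andP[/allP /(_ y yb) /andP[y0 _] _] := pfP b; lia.
Qed.

Let size_coarser a' : coarser a a' -> size a' = m.
Proof. by move=> /coarser_perm /perm_size. Qed.

Let Fset_join a' b' T : coarser a a' -> coarser b b' ->
  T \in matchings (Fset a') (Fshift b' m) ->
  Fset (join a' b' T) = joinF (Fset a') (Fshift b' m) T.
Proof.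
move=> ca cb; rewrite /join (size_coarser ca) Fset_shiftw => hT; apply: Fset_wcat.
by have [] := coarser_join (low ca) (high cb) hT.
Qed.

Let join_inj a1 b1 T1 a2 b2 T2 : coarser a a1 -> coarser b b1 ->
  coarser a a2 -> coarser b b2 ->
  T1 \in matchings (Fset a1) (Fshift b1 m) -> T2 \in matchings (Fset a2) (Fshift b2 m) ->
  join a1 b1 T1 = join a2 b2 T2 -> [/\ a1 = a2, b1 = b2 & T1 = T2].
Proof.
move=> ca1 cb1 ca2 cb2 h1 h2 /(congr1 Fset); rewrite !Fset_join // => E.
move: h1 h2 E; rewrite !Fset_shiftw => h1 h2 E.
have [] := joinF_inj (lowF (low ca1) (perm_refl _)) (highF (high cb1) (perm_refl _))
  (lowF (low ca2) (perm_refl _)) (highF (high cb2) (perm_refl _)) h1 h2 E.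
by move=> /Fset_inj-> /Fset_inj/shiftw_inj-> ->.
Qed.

(** Repetitions are excluded by [join_inj], and every coarsening of the slash product is reached by
    [coarser_slash_decode]. *)
Lemma perm_slash_coarsenings : perm_eq (coarsenings (slash a b))
  (flatten [seq [seq join p.1 p.2 T | T <- matchings (Fset p.1) (Fshift p.2 m)]
           | p <- [seq (a', b') | a' <- coarsenings a, b' <- coarsenings b]]).
Proof.
have memP p : p \in [seq (a', b') | a' <- coarsenings a, b' <- coarsenings b] ->
    coarser a p.1 /\ coarser b p.2.
  by case/allpairsP => [[a' b'] /= [ha hb ->]]; move: ha hb;
     rewrite !mem_coarsenings => /asboolP ? /asboolP.
apply: uniq_perm; first exact: coarsenings_uniq.
  apply: uniq_flatten_map => [|p /memP[ca cb]|p q c /memP[pa pb] /memP[qa qb]].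
  - by rewrite allpairs_uniq ?coarsenings_uniq // => -[? ?] [? ?] _ _ [-> ->].
  - rewrite map_inj_in_uniq ?matchings_uniq // => T T' hT hT'.
    by case/(join_inj ca cb ca cb hT hT').
  - move=> /mapP[T hT ->] /mapP[T' hT' E].
    have [e1 e2 _] := join_inj pa pb qa qb hT hT' E.
    by rewrite [p]surjective_pairing [q]surjective_pairing e1 e2.
have cs := coarsenings_map (@shiftw_mono m) b.
move=> c; rewrite mem_coarsenings val_slash; apply/asboolP/flatten_mapP.
  move=> /(coarser_slash_decode (low (coarser_refl a)) (high (coarser_refl b))).
  move=> [a' [b'' [T [ha hb]]]].
  have : b'' \in coarsenings (shiftw b m) by rewrite mem_coarsenings; apply/asboolP.
  rewrite (perm_mem cs) => /mapP[b' hb' ->]; rewrite -/(shiftw b' m) => hT E.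
  exists (a', b').
    by rewrite allpairs_f // mem_coarsenings; apply/asboolP.
  apply/mapP; exists T; rewrite /= ?Fset_shiftw //.
  by rewrite /join (size_coarser ha) Fset_shiftw -E wcat_Fset.
move=> [p /memP[pa pb] /mapP[T hT ->]].
have [pfa pfb] : is_pf p.1 /\ is_pf p.2.
  by rewrite -(is_pf_perm (coarser_perm pa)) -(is_pf_perm (coarser_perm pb)) !pfP.
have sz : size (PF pfa) = m by rewrite /= (size_coarser pa).
(* The factors are first coarsened separately and the matching is applied afterwards; transitivity
   is borrowed from [pf_le]. *)
have step1 : pf_le (slash a b) (slash (PF pfa) (PF pfb)).
  apply: coarser_pf_le; rewrite !val_slash sz /=.
  have sep (u v : word) : coarser a u -> coarser b v ->
      forall x y, x \in u -> y \in shiftw v m -> x < y.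
    by move=> cu cv x y /(low cu) h1 /(high cv); apply: leq_ltn_trans.
  have [X hX] := pa.
  have [Y hY] : coarser (shiftw b m) (shiftw p.2 m) by apply/(coarser_map (@shiftw_mono m)).
  exists (X ++ Y); rewrite !LR_sep ?coarsens_cat //; apply: sep => //; exact: coarser_refl.
have hT' := hT; rewrite Fset_shiftw in hT'.
have [_ cj] := coarser_join (low pa) (high pb) hT'.
have ej : wcat (joinF (Fset p.1) (Fset (shiftw p.2 m)) T) = join p.1 p.2 T.
  by rewrite /join (size_coarser pa) Fset_shiftw.
rewrite ej in cj.
have es : shiftw p.2 m ++ p.1 = slash (PF pfa) (PF pfb) by rewrite val_slash sz.
have pfj : is_pf (join p.1 p.2 T).
  by rewrite -(is_pf_perm (coarser_perm cj)) es pfP.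
rewrite -val_slash -[join _ _ _]/(pfw (PF pfj)); apply: pf_le_coarser.
apply: rt_trans step1 _; apply: coarser_pf_le; by rewrite /= -es.
Qed.

Lemma star_Q (K : fieldType) : star (Q K a) (Q K b) = Q K (slash a b).
Proof.
rewrite !Q_coarsenings /star linext2_sum (perm_big _ perm_slash_coarsenings).
rewrite big_flatten_map big_allpairs; apply: eq_big_seq => a' ha.
apply: eq_big_seq => b' hb; rewrite starM_matchings big_map.
rewrite !pfw_to_pf ?(pf_coarsening ha) ?(pf_coarsening hb) //.
by move: ha; rewrite mem_coarsenings => /asboolP/size_coarser ->.
Qed.

End Product.

(** * Free generation *)

Lemma pf_inj : injective pfw.
Proof. exact: val_inj. Qed.

Lemma slash_epsl a : slash pf_eps a = a.
Proof.
apply: pf_inj; rewrite val_slash cats0 /shiftw (eq_map (g := id)) ?map_id // => x.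
by rewrite /= addn0.
Qed.

Lemma slash_epsr a : slash a pf_eps = a.
Proof. by apply: pf_inj; rewrite val_slash. Qed.

Lemma slashA : associative slash.
Proof.
move=> a b c; apply: pf_inj; rewrite !val_slash size_cat size_map /shiftw map_cat.
by rewrite -map_comp -catA (eq_map (g := addn^~ (size b + size a))) // => x /=; rewrite addnA.
Qed.

Lemma size_slash (a b : pf) : size (slash a b) = size a + size b.
Proof. by rewrite val_slash size_cat size_map addnC. Qed.

Lemma pf_size0 (a : pf) : (size a == 0) = (a == pf_eps).
Proof. by rewrite size_eq0. Qed.

(** For [i] up to [size v], the letters at most [i] all lie in [v], so [v] is a parking function.
    Beyond that, [v] contributes at most [size v] letters, which leaves enough for the lowered
    [u]. *)
Lemma slash_cut (a : pf) (u v : word) : pfw a = u ++ v ->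
  (forall x, x \in u -> size v < x) ->
  exists b c : pf, [/\ a = slash b c, pfw b = v & u = shiftw c (size v)].
Proof.
move=> e hu; have /is_pfP[p c] := pfP a; rewrite e size_cat in p c.
have pv : is_pf v.
  apply/is_pfP; split=> [x xv|i iv]; first by apply: p; rewrite mem_cat xv orbT.
  have := c i; rewrite count_cat (_ : count _ u = 0) ?add0n; first by apply; lia.
  by apply/eqP; rewrite -leqn0 leqNgt -has_count; apply/hasPn => x /hu; lia.
have pu : is_pf (map (subn^~ (size v)) u).
  apply/is_pfP; split=> [x /mapP[y /hu h ->]|i]; first by rewrite subn_gt0.
  rewrite size_map => iu; have := c (i + size v); rewrite count_cat count_map.
  have := count_size (fun x => x <= i + size v) v.
  have E : preim (subn^~ (size v)) (fun x => x <= i) =1 (fun x => x <= i + size v).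
    by move=> x /=; lia.
  by rewrite (eq_count E) => h1 /(_ ltac:(lia)); lia.
have eu : u = shiftw (map (subn^~ (size v)) u) (size v).
  rewrite /shiftw -map_comp -[LHS]map_id; apply/eq_in_map => x /hu h /=; lia.
exists (PF pv), (PF pu); split=> //; apply: pf_inj.
by rewrite val_slash /= -eu.
Qed.

Definition slashes (s : seq atomic_pf) : pf := foldr (fun x => slash (val x)) pf_eps s.

Lemma slashes_cat s t : slashes (s ++ t) = slash (slashes s) (slashes t).
Proof.
by elim: s => [|x s IH] /=; rewrite ?slash_epsl // IH slashA.
Qed.

Lemma slashes_surj a : exists s, slashes s = a.
Proof.
have [n] := ubnP (size a); elim: n a => // n IH a hn.
case: (pselect (a = pf_eps)) => [->|a0]; first by exists [::].
case: (pselect (atomic a)) => [ha|na].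
  by exists [:: exist _ a (asboolT ha)]; rewrite /= slash_epsr.
have [b [c [b0 c0 E]]] : exists b c : pf, [/\ b <> pf_eps, c <> pf_eps & a = slash b c].
  by apply: contrapT => h; apply: na.
have /negbTE sb : size b != 0 by rewrite pf_size0; apply/eqP.
have /negbTE sc : size c != 0 by rewrite pf_size0; apply/eqP.
move: hn; rewrite E size_slash => hn.
have [s <-] : exists s, slashes s = b by apply: IH; lia.
have [t <-] : exists s, slashes s = c by apply: IH; lia.
by exists (s ++ t); rewrite slashes_cat.
Qed.

Lemma atomic_val (x : atomic_pf) : atomic (val x).
Proof. exact/asboolP/(valP x). Qed.

Lemma atomic_size (x : atomic_pf) : 0 < size (val x).
Proof.
by rewrite lt0n pf_size0; apply/eqP; case: (atomic_val x).
Qed.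

(** A left slash factor is a suffix of the word. If [x] were shorter than [y], it would be a suffix
    of [y] preceded by letters larger than its length, and [y] would factor. *)
Lemma slash_atomic_leq (x y : atomic_pf) a b :
  slash (val x) a = slash (val y) b -> size (val y) <= size (val x).
Proof.
move=> /(congr1 pfw); rewrite !val_slash => E; rewrite leqNgt; apply/negP => lt.
set u := pfw (val x) in E lt *; set v := pfw (val y) in E lt *.
have sE : size a + size u = size b + size v.
  by have := congr1 size E; rewrite !size_cat !size_map.
(* Both sides of [E] lose the shifted copy of [b]. *)
have Ev : v = drop (size b) (shiftw a (size u)) ++ u.
  have := congr1 (drop (size b)) E.
  rewrite [in RHS]drop_size_cat ?size_map // drop_cat size_map.
  by case: ltnP => [_ <- //|]; lia.
have [c [d [Ey Ec Ed]]] : exists c d : pf, [/\ val y = slash c d, pfw c = u &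
    drop (size b) (shiftw a (size u)) = shiftw d (size u)].
  apply: slash_cut => // z /mem_drop /mapP[t ta ->].
  by have /is_pfP[p _] := pfP a; have := p t ta; lia.
case: (atomic_val y) => _; apply; exists c, d; split=> //.
  by move=> c0; have := atomic_size x; rewrite -/u -Ec c0.
(* An empty [d] would force [size a <= size b], against [sE] and [lt]. *)
move=> d0; move: (congr1 size Ed); rewrite d0 size_drop size_map /=; lia.
Qed.

(** The first factors have equal length by [slash_atomic_leq] used both ways, so they are the same
    suffix and can be cancelled. *)
Lemma slashes_inj : injective slashes.
Proof.
elim=> [|x s IH] [|y t] //= E.
- have := atomic_size y; have := congr1 (size \o pfw) E; rewrite /= size_slash /=; lia.
- have := atomic_size x; have := congr1 (size \o pfw) E; rewrite /= size_slash /=; lia.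
have sz : size (val x) = size (val y).
  by apply/eqP; rewrite eqn_leq (slash_atomic_leq E) (slash_atomic_leq (esym E)).
move: (congr1 pfw E) => /eqP; rewrite !val_slash eqseq_cat; last first.
  by have := congr1 (size \o pfw) E; move: sz; rewrite /= !size_slash !size_map; lia.
move=> /andP[/eqP e1 /eqP /pf_inj/val_inj xy]; rewrite xy in e1 *.
by congr cons; apply: IH; apply/pf_inj/(@shiftw_inj (size (val y))).
Qed.

Lemma fmonom_slashes_bij : bijective (fun s : {fmonom atomic_pf} => slashes s).
Proof.
have /choice[g gP] : forall a, exists s : {fmonom atomic_pf}, slashes s = a.
  by move=> a; have [s <-] := slashes_surj a; exists (FMonom s).
exists g => [s|a] //; apply/eqP; rewrite fmP; apply/eqP/slashes_inj; exact: gP.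
Qed.

Lemma Q_eps (K : fieldType) : Q K pf_eps = M K pf_eps.
Proof.
rewrite Q_coarsenings (perm_big [:: [::]]) ?big_seq1 /=.
  by congr (<< _ >>)%R; apply: pf_inj; rewrite pfw_to_pf.
apply: uniq_perm; rewrite ?coarsenings_uniq // => b; rewrite mem_coarsenings inE.
apply/asboolP/eqP => [/coarser_perm|->]; last exact: coarser_refl.
by rewrite perm_sym => /perm_nilP.
Qed.

Local Open Scope ring_scope.

Lemma eq_linext (K : fieldType) (I : choiceType) (V : lmodType K) (e1 e2 : I -> V) x :
  e1 =1 e2 -> linext e1 x = linext e2 x.
Proof. by move=> /funext ->. Qed.

Lemma star_linextl (K : fieldType) (I : choiceType) (f : I -> PFSym K) x v :
  star (linext f x) v = linext (fun s => star (f s) v) x.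
Proof. exact: linext_comp. Qed.

Lemma star_linextr (K : fieldType) (I : choiceType) (f : I -> PFSym K) u y :
  star u (linext f y) = linext (fun t => star u (f t)) y.
Proof.
have E w : star u w = linext (fun b => linext ((@starM K)^~ b) u) w.
  exact: (linext2C (@starM K)).
rewrite [LHS]E (linext_comp f (fun b => linext ((@starM K)^~ b) u)).
by apply: eq_linext => t; rewrite E.
Qed.

(** The morphism sends a monomial to [Q] of the slash product of its letters. It is multiplicative
    by [star_Q], and bijective because it is the basis of the [Q a] reindexed by unique
    factorization. *)
Lemma free_Q (K : fieldType) : freely_generates (fun a : atomic_pf => Q K (val a)).
Proof.
pose f (s : {fmonom atomic_pf}) := Q K (slashes s).
have fM s t : f (mmul s t) = star (f s) (f t) by rewrite /f fmM slashes_cat star_Q.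
exists (linext f); split.
- by rewrite /= -mpolyC1E linextU /f fm1; apply: Q_eps.
- move=> x y; rewrite star_linextl malgME linear_sum; apply: eq_bigr => s _.
  rewrite star_linextr linear_sum /linext scaler_sumr; apply: eq_bigr => t _.
  by rewrite malgUZ [LHS]linearZ_LR /= linextU fM scalerA.
- by move=> a; rewrite /= linextU /f fmU /= slash_epsr.
- exact: (reindex_linext_bij fmonom_slashes_bij (Q_basis K)).
Qed.

Theorem theorem4p6 (K : fieldType) (charK : [pchar K] =i pred0) :
  [/\ is_basis (@Q K),
      forall (m n : nat) (a b : pf), a \in Pn m -> b \in Pn n ->
        star (Q K a) (Q K b) = Q K (slash a b),
      forall a : pf, Delta (Q K a) =
        \sum_(x <- splits a) tensor (Q K (Park x.1)) (Q K (Park x.2))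
    & freely_generates (fun a : atomic_pf => Q K (val a))].
Proof.
split; [exact: Q_basis | | exact: Delta_Q | exact: free_Q].
by move=> m n a b _ _; apply: star_Q.
Qed.
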